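(* Let $\mathbf n=(n_1,n_2,\dots)$ be any sequence of positive integers, with $\mathcal P$, $\Delta_{\mathbf n}$, $\Delta_{\mathbf n}^+$, $\pi$, $H$, $t$, $\hat t$, $\alpha$ as defined in the context. Then: (a) The map $H:\mathcal P\to\Delta^+_{\mathbf n}$ is a homeomorphism. (b) The map $\pi:\Delta_{\mathbf n}\to\Delta^+_{\mathbf n}$ is injective except for the case where $s=S^j(t)$ and $\hat s=S^j(\hat t)$ for the same $j\ge0$, in which case $\pi(s)=\pi(\hat s)$. (c) Each $s\in\Delta^+_{\mathbf n}$ has a unique inverse under the shift $S:\Delta^+_{\mathbf n}\to\Delta^+_{\mathbf n}$, with the sole exception that $S^{-1}(\alpha)=\{1\alpha,2\alpha\}$.
   Context: The alphabet is $\{1,2,3\}$, $\epsilon$ is the empty word, $1^m$ is the letter $1$ repeated $m$ times. For a positive integer $n$, $\Lambda_n$ is the substitution $1\mapsto 2,\ 2\mapsto 31^{n+1},\ 3\mapsto 31^n$. Fix $\mathbf n=(n_1,n_2,\dots)$, $n_i\ge1$; $\Lambda^{(0)}=\mathrm{id}$, $\Lambda^{(k)}=\Lambda_{n_1}\circ\dots\circ\Lambda_{n_k}$. Bi-infinite sequences are written $\dots s_{-2}s_{-1}.s_0s_1\dots$; words may also carry a point; substitutions act letterwise, respecting the point. $S$ is the left shift (it moves the point one place to the right), used on one-sided and two-sided sequences, and on pointed one-sided sequences as long as the point does not move beyond an end. An $\epsilon$ at an end indicates that the object stops there. $\pi(\dots s_{-1}.s_0s_1\dots)=s_0s_1\dots$.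 Sequence spaces carry the product topology. Let $\alpha=\lim_k\Lambda^{(k)}(3)$ (right infinite), $\beta=\lim_k\Lambda^{(2k)}(1)$ and $\hat\beta=\lim_k\Lambda^{(2k)}(2)$ (left infinite; limits read from the right end), $t=\beta.\alpha$, $\hat t=\hat\beta.\alpha$. $\Delta_{\mathbf n}$ is the closure of $\{S^j(t):j\in\mathbb Z\}$ in $\{1,2,3\}^{\mathbb Z}$; $\Delta^+_{\mathbf n}$ is the closure of $\{S^j(\alpha):j\ge0\}$ in the space of right infinite sequences, and equals $\pi(\Delta_{\mathbf n})$. Path space: $\mathcal P$ is the set of sequences $\Gamma=(u_i,a_i,v_i)_{i\ge0}$ with $a_i\in\{1,2,3\}$, $u_i,v_i$ possibly empty words, and $\Lambda_{n_{i+1}}(a_{i+1})=u_ia_iv_i$ for all $i\ge0$; with $\Gamma_i=(u_i,a_i,v_i)$ it has the metric $d(\Gamma,\Gamma')=1/(N+1)$, $N=\min\{i:\Gamma_i\ne\Gamma_i'\}$. Put $$\mathcal W(\Gamma)=\dots\Lambda^{(2)}(u_2)\Lambda^{(1)}(u_1)u_0.a_0v_0\Lambda^{(1)}(v_1)\Lambda^{(2)}(v_2)\dots$$ Two paths are tail equivalent if they agree from some index on. $\mathcal S_1,\mathcal S_{\hat1},\mathcal S_2$ are the tail equivalence classes of $\Gamma_\beta=(31^{n_1},1,\epsilon),\prod_{i\ge1}\big((\epsilon,2,\epsilon),(31^{n_{2i+1}},1,\epsilon)\big)$, $\Gamma_{\hat\beta}=\prod_{i\ge1}\big((\epsilon,2,\epsilon),(31^{n_{2i}},1,\epsilon)\big)$,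 $\Gamma_\alpha=\prod_{i\ge1}(\epsilon,3,1^{n_i})$ (products denote concatenation of edge labels), and $\mathcal N=\mathcal P\setminus(\mathcal S_1\cup\mathcal S_{\hat1}\cup\mathcal S_2)$. $\mathcal W(\Gamma)$ is bi-infinite exactly for $\Gamma\in\mathcal N$; for $\Gamma\in\mathcal S_1$, $\mathcal W(\Gamma)=S^j(\beta.\epsilon)$ with a unique $j<0$; for $\Gamma\in\mathcal S_{\hat1}$, $\mathcal W(\Gamma)=S^j(\hat\beta.\epsilon)$ with a unique $j<0$; for $\Gamma\in\mathcal S_2$, $\mathcal W(\Gamma)=S^j(\epsilon.\alpha)$ with a unique $j\ge0$. The map $H:\mathcal P\to\Delta^+_{\mathbf n}$ is defined by $H(\Gamma)=\pi(\mathcal W(\Gamma))$ for $\Gamma\in\mathcal N$, $H(\Gamma)=\pi(S^j(t))$ for $\Gamma\in\mathcal S_1\cup\mathcal S_2$, and $H(\Gamma)=\pi(S^j(\hat t))$ for $\Gamma\in\mathcal S_{\hat1}$, with the indicated $j$ in each case. *)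

(* Defs.v *)
From HB Require Import structures.
From mathcomp Require Import all_boot all_order all_algebra.
From mathcomp Require Import all_classical all_reals.
From mathcomp Require Import topology.

Set Implicit Arguments.
Unset Strict Implicit.
Unset Printing Implicit Defensive.

Import Order.TTheory GRing.Theory Num.Theory.

Local Open Scope classical_set_scope.
Local Open Scope ring_scope.

(* Throughout, a sequence (n_1, n_2, ...) of positive integers is a function
   n : nat -> nat with n i standing for n_{i+1}; positivity is a hypothesis of
   the results, the definitions do not need it. *)

Inductive letter := L1 | L2 | L3.

Definition letter_code (a : letter) : 'I_3 :=
  match a with L1 => inord 0 | L2 => inord 1 | L3 => inord 2 end.
Definition letter_decode (i : 'I_3) : letter :=
  match val i with 0%N => L1 | 1%N => L2 | _ => L3 end.
Lemma letter_codeK : cancel letter_code letter_decode.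
Proof. by case; rewrite /letter_decode /= inordK. Qed.

HB.instance Definition _ := Countable.copy letter (can_type letter_codeK).
HB.instance Definition _ := isPointed.Build letter L1.
HB.instance Definition _ := hasNbhs.Build letter principal_filter.
HB.instance Definition _ := Discrete_ofNbhs.Build letter erefl.

Definition word := seq letter.

Definition biseq : Type := {ptws int -> letter}.
Definition oneseq : Type := {ptws nat -> letter}.
HB.instance Definition _ := Topological.on biseq.
HB.instance Definition _ := Topological.on oneseq.

(* Possibly terminating sequences: None marks the places beyond the end.
   An element x : oseq is a word or an infinite sequence with one marked end,
   x i being the letter at distance i from that end (the left end for right
   infinite sequences, the right end for left infinite ones). *)
Definition oseq : Type := {ptws nat -> discrete_topology (option letter)}.
HB.instance Definition _ := Topological.on oseq.
HB.instance Definition _ := isPointed.Build oseq (fun=> None).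

Definition oword (w : word) : oseq := onth w.

(* Limits in the product topology; llim reads words from the right end. *)
Definition rlim (w : nat -> word) : oseq := limn (oword \o w).
Definition llim (w : nat -> word) : oseq := limn (oword \o rev \o w).

(* The pointed sequence x.y, with x read leftwards from the point. *)
Definition pjoin (x y : oseq) : int -> option letter :=
  fun i => match i with Posz k => y k | Negz k => x k end.
Definition eps : oseq := fun=> None.

(* Forgets that a sequence without end is written with option letters; the
   default letter is irrelevant for such sequences. *)
Definition strip (I : Type) (x : I -> option letter) : I -> letter :=
  fun i => odflt L1 (x i).

Definition shift (x : oneseq) : oneseq := fun i => x i.+1.
Definition scons (a : letter) (x : oneseq) : oneseq :=
  fun i => if i is k.+1 then x k else a.
(* shiftz j is S^j on two-sided or pointed one-sided sequences. *)
Definition shiftz (T : Type) (j : int) (x : int -> T) : int -> T :=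
  fun i => x (i + j).
Definition proj_right (x : biseq) : oneseq := fun i => x (Posz i).

Definition Lambda (m : nat) (a : letter) : word :=
  match a with
  | L1 => [:: L2]
  | L2 => L3 :: nseq m.+1 L1
  | L3 => L3 :: nseq m L1
  end.
Definition Lambda_word (m : nat) (w : word) : word := flatten (map (Lambda m) w).

Fixpoint Lam (n : nat -> nat) (k : nat) (w : word) : word :=
  if k is k'.+1 then Lam n k' (Lambda_word (n k') w) else w.

Section Sequences.
Variable n : nat -> nat.

Definition oalpha : oseq := rlim (fun k => Lam n k [:: L3]).
Definition obeta : oseq := llim (fun k => Lam n k.*2 [:: L1]).
Definition ohbeta : oseq := llim (fun k => Lam n k.*2 [:: L2]).

Definition alpha : oneseq := strip oalpha.
Definition t_seq : biseq := strip (pjoin obeta oalpha).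
Definition t_hat : biseq := strip (pjoin ohbeta oalpha).

Definition Delta : set biseq := closure (range (fun j => shiftz j t_seq : biseq)).
Definition DeltaP : set oneseq :=
  closure (range (fun j : nat => iter j shift alpha)).

(* (u, a, v) *)
Definition edge := (word * letter * word)%type.
Definition eu (e : edge) : word := e.1.1.
Definition ea (e : edge) : letter := e.1.2.
Definition ev (e : edge) : word := e.2.

Definition is_path : set (nat -> edge) :=
  [set G | forall i, Lambda (n i) (ea (G i.+1)) = eu (G i) ++ ea (G i) :: ev (G i)].

(* W(G), as a possibly terminating pointed sequence. *)
Definition W (G : nat -> edge) : int -> option letter :=
  pjoin (llim (fun k => flatten (rev (mkseq (fun i => Lam n i (eu (G i))) k))))
        (rlim (fun k => ea (G 0%N) :: flatten (mkseq (fun i => Lam n i (ev (G i))) k))).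

Definition tail_equiv (G G' : nat -> edge) : Prop :=
  exists N, forall i, (N <= i)%N -> G i = G' i.

Definition gamma_beta : nat -> edge := fun i =>
  if odd i then ([::], L2, [::]) else (L3 :: nseq (n i) L1, L1, [::]).
Definition gamma_hbeta : nat -> edge := fun i =>
  if odd i then (L3 :: nseq (n i) L1, L1, [::]) else ([::], L2, [::]).
Definition gamma_alpha : nat -> edge := fun i => ([::], L3, nseq (n i) L1).

(* The j in D with x = S^j(y); xget returns 0 if there is none. *)
Definition exponent (D : set int) (x y : int -> option letter) : int :=
  xget 0 [set j | D j /\ x = shiftz j y].

Definition Hmap (G : nat -> edge) : oneseq :=
  if `[< tail_equiv G gamma_beta >] then
    proj_right (shiftz (exponent [set j | j < 0] (W G) (pjoin obeta eps)) t_seq)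
  else if `[< tail_equiv G gamma_hbeta >] then
    proj_right (shiftz (exponent [set j | j < 0] (W G) (pjoin ohbeta eps)) t_hat)
  else if `[< tail_equiv G gamma_alpha >] then
    proj_right (shiftz (exponent [set j | 0 <= j] (W G) (pjoin eps oalpha)) t_seq)
  else proj_right (strip (W G)).

End Sequences.

(* The parameter R is only the type in which distances take their values. *)
Definition path_space (R : realType) (n : nat -> nat) : Type :=
  set_type (is_path n).
HB.instance Definition _ R n := Choice.on (path_space R n).

Definition path_edges (R : realType) (n : nat -> nat) (G : path_space R n) :
  nat -> edge := set_val G.
Coercion path_edges : path_space >-> Funclass.

Section PathMetric.
Variables (R : realType) (n : nat -> nat).
Implicit Types G : path_space R n.

Definition path_dist G G' : R :=
  if pselect (exists i, G i != G' i) is left h then (ex_minn h).+1%:R^-1 else 0.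

Lemma path_ext G G' : (forall i, G i = G' i) -> G = G'.
Proof. by move=> GG'; apply: val_inj; apply/funext. Qed.

Lemma path_distxx G : path_dist G G = 0.
Proof. by rewrite /path_dist; case: pselect => // h; exfalso; case: h => i; rewrite eqxx. Qed.

Lemma path_dist_positivity G G' : path_dist G G' = 0 -> G = G'.
Proof.
rewrite /path_dist; case: pselect => [h /eqP|h _].
  by rewrite invr_eq0 pnatr_eq0.
by apply: path_ext => i; apply/eqP; apply: contra_notT h => ?; exists i.
Qed.

Lemma path_dist_sym G G' : path_dist G G' = path_dist G' G.
Proof.
rewrite /path_dist; case: pselect => h; case: pselect => h' //.
- do 2 case: ex_minnP => ? ? ?; congr (_.+1%:R^-1).
  by apply/eqP; rewrite eqn_leq; apply/andP; split;
    match goal with E : forall _, _ -> is_true (leq ?x _) |- is_true (leq ?x _) =>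
      apply: E; rewrite eq_sym end.
- by case: h' ; case: h => i; exists i; rewrite eq_sym.
- by case: h; case: h' => i; exists i; rewrite eq_sym.
Qed.

Lemma path_dist_ge0 G G' : 0 <= path_dist G G'.
Proof. by rewrite /path_dist; case: pselect => // h; rewrite invr_ge0. Qed.

Lemma path_dist_ge G G' i : G i != G' i -> i.+1%:R^-1 <= path_dist G G'.
Proof.
rewrite /path_dist => GG'; case: pselect => [h|[]]; last by exists i.
by case: ex_minnP => m _ /(_ i GG') mi; rewrite lef_pV2 ?posrE// ler_nat.
Qed.

Lemma path_dist_triangle G' G G'' :
  path_dist G G'' <= path_dist G G' + path_dist G' G''.
Proof.
rewrite {1}/path_dist; case: pselect => h; last by rewrite addr_ge0 ?path_dist_ge0.
case: ex_minnP => i GG'' _.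
have [GG'|GG'] := eqVneq (G i) (G' i).
  by rewrite ler_wpDl ?path_dist_ge0// path_dist_ge// -GG'.
by rewrite ler_wpDr ?path_dist_ge0// path_dist_ge.
Qed.

HB.instance Definition _ := isMetric.Build R (path_space R n)
  path_distxx path_dist_positivity path_dist_sym path_dist_triangle.

End PathMetric.

Definition homeomorphism_onto (X Y : topologicalType) (B : set Y) (f : X -> Y) :=
  [/\ continuous f, set_bij [set: X] B f &
      exists2 g : Y -> X, cancel f g & {within B, continuous g}].

(* The limits above exist: alpha, t_seq and t_hat are sequences without ends. *)

Lemma rlim_eq (w : nat -> word) (x : oseq) :
  (forall i, exists K, forall k, (K <= k)%N -> onth (w k) i = x i) -> rlim w = x.
Proof.
move=> wx; apply: cvg_lim.
  by apply: hausdorff_product => ?; exact: discrete_hausdorff.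
apply/cvg_sup => i; apply/cvg_image.
  by rewrite eqEsubset; split => // o _; exists (fun=> o).
move=> U /principal_filterP Ux; have [K wK] := wx i.
exists [set y : oseq | U (y i)]; last first.
  by rewrite eqEsubset; split => [o [y Uy <-]|o Uo] //; exists (fun=> o).
by exists K => // k /= Kk; rewrite /oword wK.
Qed.

Lemma llim_eq (w : nat -> word) (x : oseq) :
  (forall i, exists K, forall k, (K <= k)%N -> onth (rev (w k)) i = x i) ->
  llim w = x.
Proof. exact: (@rlim_eq (rev \o w)). Qed.

Lemma rlim_mono (w : nat -> word) :
    (forall k, exists2 s, s != [::] & w k.+1 = w k ++ s) ->
  rlim w = (fun i => Some (nth L1 (w i.+1) i)).
Proof.
move=> ws; have szw k : (k <= size (w k))%N.
  elim: k => // k IH; have [[//|a s] _ ->] := ws k.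
  by rewrite size_cat /= addnS ltnS (leq_trans IH) ?leq_addr.
apply: rlim_eq => i; exists i.+1; elim=> // k IH.
rewrite leq_eqVlt => /predU1P[<-|].
  by rewrite onthE (nth_map L1).
rewrite ltnS => ik; rewrite -(IH ik); have [s _ ->] := ws k.
by rewrite !onthE map_cat nth_cat size_map (leq_trans ik).
Qed.

Lemma llim_mono (w : nat -> word) :
    (forall k, exists2 s, s != [::] & w k.+1 = s ++ w k) ->
  llim w = (fun i => Some (nth L1 (rev (w i.+1)) i)).
Proof.
move=> ws; apply: (@rlim_mono (rev \o w)) => k; have [s s0 wk] := ws k.
by exists (rev s); rewrite /= ?wk ?rev_cat // -size_eq0 size_rev size_eq0.
Qed.

Lemma Lam_cat n k w1 w2 : Lam n k (w1 ++ w2) = Lam n k w1 ++ Lam n k w2.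
Proof. by elim: k w1 w2 => //= k IH w1 w2; rewrite /Lambda_word map_cat flatten_cat IH. Qed.

Lemma Lam_neq0 n k w : w != [::] -> Lam n k w != [::].
Proof. by elim: k w => //= k IH [//|a w] _; apply: IH; case: a. Qed.

Lemma oalphaE n i : (forall i, (0 < n i)%N) -> oalpha n i = Some (alpha n i).
Proof.
move=> n0; rewrite /alpha /strip /oalpha rlim_mono // => k.
exists (Lam n k (nseq (n k) L1)); last by rewrite -Lam_cat /= /Lambda_word /= cats0.
by apply: Lam_neq0; case: (n k) (n0 k).
Qed.

Lemma nseqSr (m : nat) (a : letter) : nseq m.+1 a = nseq m a ++ [:: a].
Proof. by rewrite -addn1 nseqD. Qed.

Lemma obetaE n i : obeta n i = Some (t_seq n (Negz i)).
Proof.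
rewrite /t_seq /strip /pjoin /obeta llim_mono // => k.
exists (Lam n k.*2 (L3 :: nseq (n k.*2) L1)); first exact: Lam_neq0.
by rewrite -Lam_cat doubleS cat_cons -nseqSr /= /Lambda_word /= cats0.
Qed.

Lemma ohbetaE n i : ohbeta n i = Some (t_hat n (Negz i)).
Proof.
rewrite /t_hat /strip /pjoin /ohbeta llim_mono // => k.
exists (Lam n k.*2 (Lambda_word (n k.*2) (L3 :: nseq (n k.*2.+1) L1))).
  by apply: Lam_neq0; rewrite /Lambda_word.
rewrite -Lam_cat doubleS -[LHS]/(Lam n k.*2 (Lambda_word (n k.*2)
  ((L3 :: nseq (n k.*2.+1).+1 L1) ++ [::]))) cats0 nseqSr -cat_cons.
by rewrite /Lambda_word map_cat flatten_cat.
Qed.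

Lemma gamma_beta_path n : is_path n (gamma_beta n).
Proof.
by move=> i; rewrite /gamma_beta oddS; case: (odd i); rewrite //= -nseqSr.
Qed.

Lemma gamma_hbeta_path n : is_path n (gamma_hbeta n).
Proof.
by move=> i; rewrite /gamma_hbeta oddS; case: (odd i); rewrite //= -nseqSr.
Qed.

Lemma gamma_alpha_path n : is_path n (gamma_alpha n).
Proof. by []. Qed.

(* Main.v *)
Require Import Defs.
From mathcomp Require Import all_boot all_order all_algebra.
From mathcomp Require Import all_classical all_reals.
From mathcomp Require Import topology zify.

(** Idea. A sequence s of Delta^+ splits in exactly one way as s = a v
    Lambda(x_1) Lambda(x_2) ..., with Lambda(x_0) = u a v and x in the space
    Delta^+ of the shifted sequence (n_2, n_3, ...), and (u, a, v) is visible on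
    a bounded prefix of s: a maximal run of 1's is followed by 2 when it ends a
    block Lambda(3) and by 3 when it ends a block Lambda(2). Iterating this
    desubstitution gives a continuous map from Delta^+ to paths, inverse to H.
    If every v_i vanishes from some index on, s is w alpha for a suffix w of
    beta or of beta-hat, which is why H completes such a path with alpha.

    If two distinct letters can precede s, then s = Lambda(s') where two
    distinct letters can precede s', and s begins with 3; iterating, s = alpha.
    This gives (c), and, with the aperiodicity of alpha, (b). *)

Set Implicit Arguments.
Unset Strict Implicit.
Unset Printing Implicit Defensive.

(** * Infinite sequences and substitution *)

Definition tail (T : Type) (f : nat -> T) : nat -> T := fun i => f i.+1.

Definition scat (w : word) (s : oneseq) : oneseq := foldr scons s w.

Definition starts (s : oneseq) (w : word) := exists z, s = scat w z.

Definition agree (K : nat) (s s' : oneseq) := forall i, i < K -> s i = s' i.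

Lemma scons_shift s : scons (s 0) (shift s) = s.
Proof. by apply/funext; case. Qed.

Lemma iter_shiftE k s i : iter k shift s i = s (i + k).
Proof. by elim: k i => [|k IH] i; rewrite ?addn0 //= /shift IH addSnnS. Qed.

Lemma iter_tailE T k (f : nat -> T) i : iter k (@tail T) f i = f (i + k).
Proof. by elim: k i => [|k IH] i; rewrite ?addn0 //= /tail IH addSnnS. Qed.

Lemma scat_cat w1 w2 s : scat (w1 ++ w2) s = scat w1 (scat w2 s).
Proof. exact: foldr_cat. Qed.

Lemma scatE w s i : scat w s i = if i < size w then nth L1 w i else s (i - size w).
Proof. by elim: w i => [|a w IH] [|i] //=; rewrite ltnS IH. Qed.

Lemma iter_shift_scat w s : iter (size w) shift (scat w s) = s.
Proof. by apply/funext => i; rewrite iter_shiftE scatE ltnNge leq_addl /= addnK. Qed.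

Lemma scat_mkseq k s : scat (mkseq s k) (iter k shift s) = s.
Proof.
apply/funext => i; rewrite scatE size_mkseq iter_shiftE.
by case: ltnP => ik; rewrite ?nth_mkseq ?subnK.
Qed.

Lemma shift_scat a w s : shift (scat (a :: w) s) = scat w s.
Proof. by []. Qed.

Lemma starts_nth s w i : starts s w -> i < size w -> s i = nth L1 w i.
Proof. by move=> [z ->] iw; rewrite scatE iw. Qed.

Lemma starts_catl s w w' : starts s (w ++ w') -> starts s w.
Proof. by case=> z ->; exists (scat w' z); rewrite scat_cat. Qed.

Lemma starts_mkseq s k : starts s (mkseq s k).
Proof. by exists (iter k shift s); rewrite scat_mkseq. Qed.

Lemma starts_agree s s' w : starts s w -> starts s' w -> agree (size w) s s'.
Proof. by move=> sw s'w i iw; rewrite (starts_nth sw) // (starts_nth s'w). Qed.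

Lemma starts_eq s s' :
  (forall L, exists w, [/\ L <= size w, starts s w & starts s' w]) -> s = s'.
Proof.
by move=> h; apply/funext => i; have [w [iw sw /(starts_agree sw)]] := h i.+1; apply.
Qed.

Lemma agree_starts s s' w : agree (size w) s s' -> starts s w -> starts s' w.
Proof.
move=> ss' sw; exists (iter (size w) shift s').
rewrite -[LHS](scat_mkseq (size w)); congr scat.
apply: (@eq_from_nth _ L1); rewrite size_mkseq // => i iw.
by rewrite nth_mkseq // -ss' // (starts_nth sw).
Qed.

Lemma starts_mkseqE s w : starts s w -> mkseq s (size w) = w.
Proof.
move=> sw; apply: (@eq_from_nth _ L1); rewrite size_mkseq // => i iw.
by rewrite nth_mkseq // (starts_nth sw).
Qed.

Lemma mkseqD (T : Type) (f : nat -> T) k d :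
  mkseq f (k + d) = mkseq f k ++ mkseq (fun i => f (k + i)) d.
Proof. by rewrite /mkseq iotaD map_cat add0n -{2}[k]addn0 iotaDl -map_comp. Qed.

Lemma agree_mkseq K s s' : agree K s s' -> mkseq s K = mkseq s' K.
Proof.
move=> ss'; apply: (@eq_from_nth _ L1); rewrite !size_mkseq // => i iK.
by rewrite !nth_mkseq // ss'.
Qed.

Lemma agree_scons K a a' s s' :
  agree K.+1 (scons a s) (scons a' s') -> a = a' /\ agree K s s'.
Proof. by move=> h; split=> [|i iK]; [exact: (h 0) | exact: (h i.+1)]. Qed.

Lemma agree_scat K w s s' :
  agree (size w + K) (scat w s) (scat w s') -> agree K s s'.
Proof.
move=> h i iK; have := h (size w + i); rewrite ltn_add2l => /(_ iK).
by rewrite !scatE ltnNge leq_addr /= addKn.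
Qed.

Lemma agreeW K K' s s' : K' <= K -> agree K s s' -> agree K' s s'.
Proof. by move=> KK h i iK; apply: h; apply: leq_trans KK. Qed.

Lemma Lambda_word_cat m w1 w2 :
  Lambda_word m (w1 ++ w2) = Lambda_word m w1 ++ Lambda_word m w2.
Proof. by rewrite /Lambda_word map_cat flatten_cat. Qed.

Lemma Lambda_word1 m a : Lambda_word m [:: a] = Lambda m a.
Proof. exact: cats0. Qed.

Lemma size_Lambda m a : 0 < size (Lambda m a).
Proof. by case: a. Qed.

Lemma size_Lambda_le m a : size (Lambda m a) <= m.+2.
Proof. by case: a; rewrite //= size_nseq. Qed.

Lemma size_Lambda_word m w : size w <= size (Lambda_word m w).
Proof.
elim: w => // a w IH; rewrite -cat1s Lambda_word_cat Lambda_word1 !size_cat.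
exact: leq_add (size_Lambda _ _) IH.
Qed.

Lemma size_Lambda_word_le m w : size (Lambda_word m w) <= m.+2 * size w.
Proof.
elim: w => // a w IH; rewrite -cat1s Lambda_word_cat Lambda_word1 !size_cat mulnDr.
by apply: leq_add IH; rewrite muln1 size_Lambda_le.
Qed.

(** Letter [i] is read off the image of the first [i.+1] letters. This image is long enough because
    no letter has an empty image, and [LambdaS_nth] shows that any other long enough prefix gives
    the same letter. *)
Definition LambdaS (m : nat) (s : oneseq) : oneseq :=
  fun i => nth L1 (Lambda_word m (mkseq s i.+1)) i.

Lemma LambdaS_nth m s k i : i < size (Lambda_word m (mkseq s k)) ->
  LambdaS m s i = nth L1 (Lambda_word m (mkseq s k)) i.
Proof.
move=> ik; have ii : i < size (Lambda_word m (mkseq s i.+1)).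
  by apply: leq_trans (size_Lambda_word _ _); rewrite size_mkseq.
rewrite /LambdaS; case: (leqP i.+1 k) => h.
  by rewrite -(subnKC h) mkseqD Lambda_word_cat nth_cat ii.
by rewrite -(subnKC (ltnW h)) mkseqD Lambda_word_cat nth_cat ik.
Qed.

Lemma LambdaS_scons m a s : LambdaS m (scons a s) = scat (Lambda m a) (LambdaS m s).
Proof.
apply/funext => i; rewrite scatE.
have ms k : mkseq (scons a s) k.+1 = a :: mkseq s k.
  by rewrite -[k.+1]add1n mkseqD /=; congr cons; apply: eq_mkseq.
have iS : i < size (Lambda_word m (mkseq (scons a s) i.+2)).
  by apply: leq_trans (size_Lambda_word _ _); rewrite size_mkseq ltnW.
rewrite (LambdaS_nth iS) ms -cat1s Lambda_word_cat Lambda_word1 nth_cat.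
case: ltnP => // ai; rewrite (@LambdaS_nth _ _ i.+1) //.
apply: leq_trans (size_Lambda_word _ _); rewrite size_mkseq ltnS; exact: leq_subr.
Qed.

Lemma LambdaS_scat m w s : LambdaS m (scat w s) = scat (Lambda_word m w) (LambdaS m s).
Proof.
elim: w => // a w IH.
by rewrite /= LambdaS_scons IH -scat_cat -cat1s Lambda_word_cat Lambda_word1.
Qed.

Lemma LambdaS_eq m s : LambdaS m s = scat (Lambda m (s 0)) (LambdaS m (shift s)).
Proof. by rewrite -LambdaS_scons scons_shift. Qed.

Lemma LambdaS_head m s : LambdaS m s 0 <> L1.
Proof. by rewrite LambdaS_eq; case: (s 0). Qed.

(** The block of 1 begins with 2 and the other two blocks with 3, so the head of an image tells only
    whether the first letter is 1. *)
Lemma LambdaS_head2 m s : LambdaS m s 0 = L2 <-> s 0 = L1.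
Proof. by rewrite LambdaS_eq; case: (s 0). Qed.

(* A block [3 1^j] is followed by a letter other than [1], so the first block of
   an image under [Lambda m] is visible on its first [m + 3] letters. *)
Lemma agree_ones K i j (s s' : oneseq) : i < K -> j < K -> s 0 <> L1 -> s' 0 <> L1 ->
  agree K (scat (nseq i L1) s) (scat (nseq j L1) s') -> i = j /\ agree (K - i) s s'.
Proof.
move=> + + s1 s1'; elim: K i j => [|K IH] [|i] [|j] //= iK jK h.
- by case: s1; exact: (h 0).
- by case: s1'; rewrite -(h 0).
- have [_ /IH] := agree_scons h; rewrite subSS => /(_ iK jK) [-> ?] //.
Qed.

(** Blocks have at most [m.+2] letters, and one further letter is needed to see where the last block
    ends. *)
Lemma agree_LambdaS m L s s' :
  agree (m.+2 * L).+1 (LambdaS m s) (LambdaS m s') -> agree L s s'.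
Proof.
elim: L s s' => // L IH s s' h.
have h0 : s 0 = s' 0.
  have {}h : agree m.+3 (LambdaS m s) (LambdaS m s').
    by apply: agreeW h; rewrite mulnS ltnS leq_addr.
  move: h; rewrite (LambdaS_eq m s) (LambdaS_eq m s'); have := @LambdaS_head m (shift s).
  have := @LambdaS_head m (shift s'); move: (LambdaS _ _) => z z1.
  move: (LambdaS _ _) => z' z1'.
  (* Only the pairs 2, 3 and 3, 2 survive. For them [agree_ones] would equate runs of [m.+1] and [m]
     ones. *)
  case: (s 0) (s' 0) => [] [] // h; try by have := h 0 isT.
  - have [] := agree_ones (ltnSn _) (ltnW (ltnSn _)) z1' z1 (agree_scons h).2; lia.
  - have [] := agree_ones (ltnW (ltnSn _)) (ltnSn _) z1' z1 (agree_scons h).2; lia.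
move=> [|i] // iL; apply: (IH (shift s) (shift s')) => //.
apply: (@agree_scat _ (Lambda m (s 0))); rewrite -LambdaS_eq {2}h0 -LambdaS_eq.
by apply: agreeW h; rewrite mulnS; have := size_Lambda_le m (s 0); lia.
Qed.

Lemma LambdaS_inj m s s' : LambdaS m s = LambdaS m s' -> s = s'.
Proof.
by move=> E; apply/funext => i; apply: (@agree_LambdaS m i.+1) => // j _; rewrite E.
Qed.

(** * Factors of alpha and desubstitution *)

(** [Lam] is defined by peeling off the innermost substitution. Peeling off the outermost one is
    what inductions passing from [n] to [tail n] need. *)
Lemma Lam_tail n k w : Lam n k.+1 w = Lambda_word (n 0) (Lam (tail n) k w).
Proof. by elim: k w => // k IH w; rewrite -[LHS]/(Lam n k.+1 _) IH. Qed.

Lemma Lam_add n i k w : Lam n (i + k) w = Lam n i (Lam (iter i (@tail nat) n) k w).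
Proof. by elim: i n => // i IH n; rewrite addSn !Lam_tail IH -iterSr. Qed.

Lemma size_Lam n k w : size w <= size (Lam n k w).
Proof.
by elim: k w => // k IH w; apply: leq_trans (IH _); exact: size_Lambda_word.
Qed.

Lemma infix_Lam n k w w' : infix w w' -> infix (Lam n k w) (Lam n k w').
Proof. by move=> /infixP[p [q ->]]; rewrite !Lam_cat infix_infix. Qed.

Definition lang (n : nat -> nat) (w : word) := exists k, infix w (Lam n k [:: L3]).

(** Combinatorial form of membership in the one-sided space: all prefixes are factors of alpha.
    [DeltaPE] makes the identification. *)
Definition admissible (n : nat -> nat) (s : oneseq) := forall k, lang n (mkseq s k).

(** Pairs excluded here never occur in alpha ([lang_sorted]). Since 3 is followed only by 1 and 2
    never by 1, knowing whether the next letter is 1 separates 2 from 3. *)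
Definition ok (a b : letter) :=
  match a, b with L1, _ | L2, L2 | L2, L3 | L3, L1 => true | _, _ => false end.

Lemma lang_infix n w w' : infix w w' -> lang n w' -> lang n w.
Proof. by move=> ww' [k w'k]; exists k; exact: infix_trans w'k. Qed.

Lemma lang_Lam n i w : lang (iter i (@tail nat) n) w -> lang n (Lam n i w).
Proof. by move=> [k wk]; exists (i + k); rewrite Lam_add infix_Lam. Qed.

Lemma path_ok_ones j w : path ok L1 (nseq j L1 ++ w) = path ok L1 w.
Proof. by elim: j => //= j ->. Qed.

(** A block is either 2, followed by the 2 or 3 that begins the next block, or it ends in 1, which
    any letter may follow. Positivity of [m] puts a 1 after each 3. *)
Lemma sorted_Lambda_word m w : 0 < m -> sorted ok w -> sorted ok (Lambda_word m w).
Proof.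
case: m => // m _.
have H a v : path ok a v ->
    path ok (head L1 (Lambda m.+1 a)) (behead (Lambda m.+1 a) ++ Lambda_word m.+1 v).
  elim: v a => [|b v IH] a; first by rewrite cats0; case: a => _ //=; rewrite -[nseq _ _]cats0 path_ok_ones.
  rewrite -[b :: v]cat1s Lambda_word_cat Lambda_word1 => /= /andP[ab /IH].
  by case: a b ab => [] [] //= _; rewrite ?path_ok_ones /= ?path_ok_ones.
case: w => // a w /H; rewrite -[a :: w]cat1s Lambda_word_cat Lambda_word1.
by case: a.
Qed.

Lemma lang_sorted n w : (forall i, 0 < n i) -> lang n w -> sorted ok w.
Proof.
move=> n0 [k /infixP[p [q E]]].
have : sorted ok (Lam n k [:: L3]).
  elim: k n n0 {E} => // k IH n n0; rewrite Lam_tail sorted_Lambda_word // IH //.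
  by move=> i; exact: n0.
by rewrite E => /cat_sorted2[_ /cat_sorted2[]].
Qed.

Lemma infix_mkseq (s : oneseq) j k : infix (mkseq (iter j shift s) k) (mkseq s (j + k)).
Proof.
rewrite mkseqD; suff -> : mkseq (fun i => s (j + i)) k = mkseq (iter j shift s) k.
  exact: suffix_infix.
by apply: eq_mkseq => i; rewrite iter_shiftE addnC.
Qed.

Lemma admissible_shift n s j : admissible n s -> admissible n (iter j shift s).
Proof. by move=> sn k; apply: lang_infix (sn (j + k)); exact: infix_mkseq. Qed.

Lemma admissible_starts n s :
  (forall L, exists w, [/\ L <= size w, starts s w & lang n w]) -> admissible n s.
Proof.
move=> h k; have [w [kw sw]] := h k; apply: lang_infix.
by rewrite -(starts_mkseqE sw) -(subnKC kw) mkseqD prefix_infix.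
Qed.

Lemma admissible_ok n s : (forall i, 0 < n i) -> admissible n s -> ok (s 0) (s 1).
Proof. by move=> n0 sn; have := lang_sorted n0 (sn 2); rewrite /= andbT. Qed.

Lemma admissible_agree n s :
  (forall K, exists s', admissible n s' /\ agree K s s') -> admissible n s.
Proof.
by move=> h k; have [s' [sn' ss']] := h k; rewrite (agree_mkseq ss').
Qed.

(** In contrast to [rlim_mono], the words may stop growing, as happens for the two halves of [W]. A
    place that no word reaches then carries [None]. *)
Lemma rlim_prefix (w : nat -> word) i : (forall k, prefix (w k) (w k.+1)) ->
  (forall k, i < size (w k) -> rlim w i = Some (nth L1 (w k) i)) /\
  ((forall k, size (w k) <= i) -> rlim w i = None).
Proof.
move=> wS; have wD k d : prefix (w k) (w (k + d)).
  elim: d => [|d IH]; first by rewrite addn0 prefix_refl.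
  by rewrite addnS; apply: prefix_trans IH _.
have onth_w k k' j : k <= k' -> j < size (w k) -> onth (w k') j = onth (w k) j.
  by move=> kk' jk; have /prefixP[v] := wD k (k' - k); rewrite subnKC // => ->; rewrite onth_cat jk.
pose x : oseq := fun j => if pselect (exists k, j < size (w k)) is left h
                  then onth (w (projT1 (cid h))) j else None.
have xE j k : j < size (w k) -> x j = onth (w k) j.
  rewrite /x => jk; case: pselect => [h|[]]; last by exists k.
  case: cid => k' /= jk'; case: (leqP k k') => kk; first exact: onth_w.
  by symmetry; apply: onth_w => //; exact: ltnW.
rewrite (@rlim_eq _ x); last first.
  move=> j; case: (pselect (exists k, j < size (w k))) => [[k jk]|h].
    by exists k => k' kk'; rewrite (xE _ _ jk) (onth_w k).
  exists 0 => k _; rewrite /x; case: pselect => // _; rewrite onth_default // leqNgt.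
  by apply/negP => jk; apply: h; exists k.
split=> [k ik|h]; first by rewrite (xE _ _ ik) onthE (nth_map L1).
rewrite /x; case: pselect => // ik; exfalso; case: ik => k.
by rewrite ltnNge h.
Qed.

Section Alpha.
Variable n : nat -> nat.
Hypothesis n0 : forall i, 0 < n i.

Lemma Lam3S k : Lam n k.+1 [:: L3] = Lam n k [:: L3] ++ Lam n k (nseq (n k) L1).
Proof. by rewrite -Lam_cat -[LHS]/(Lam n k _) Lambda_word1. Qed.

Lemma size_Lam3 k : k < size (Lam n k [:: L3]).
Proof.
elim: k => // k IH; rewrite Lam3S size_cat -addn1.
by apply: leq_add => //; apply: leq_trans (size_Lam _ _ _); rewrite size_nseq.
Qed.

Lemma oalpha_nth k i : i < size (Lam n k [:: L3]) ->
  oalpha n i = Some (nth L1 (Lam n k [:: L3]) i).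
Proof.
move=> ik; have [|h _] := @rlim_prefix (fun k => Lam n k [:: L3]) i.
  by move=> j; rewrite Lam3S prefix_prefix.
exact: h.
Qed.

Lemma alpha_starts k : starts (alpha n) (Lam n k [:: L3]).
Proof.
have -> : Lam n k [:: L3] = mkseq (alpha n) (size (Lam n k [:: L3])).
  apply: (@eq_from_nth _ L1); rewrite ?size_mkseq // => i ik.
  by rewrite nth_mkseq // /alpha /strip (oalpha_nth ik).
exact: starts_mkseq.
Qed.

Lemma alpha0 : alpha n 0 = L3.
Proof. exact: (starts_nth (alpha_starts 0)). Qed.

Lemma admissible_alpha : admissible n (alpha n).
Proof.
apply: admissible_starts => L; exists (Lam n L [:: L3]); split.
- exact: ltnW (size_Lam3 _).
- exact: alpha_starts.
- by exists L; rewrite infix_refl.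
Qed.

Lemma starts_alpha s : (forall k, starts s (Lam n k [:: L3])) -> s = alpha n.
Proof.
move=> h; apply: starts_eq => L; exists (Lam n L [:: L3]).
by split=> //; [exact: ltnW (size_Lam3 _) | exact: alpha_starts].
Qed.

Lemma lang_alpha w : lang n w -> exists p, starts (iter p shift (alpha n)) w.
Proof.
move=> [k /infixP[p [q E]]]; exists (size p).
by have [z] := alpha_starts k; rewrite E !scat_cat => ->; rewrite iter_shift_scat; exists (scat q z).
Qed.

Lemma admissibleP s :
  admissible n s <-> forall K, exists p, agree K s (iter p shift (alpha n)).
Proof.
split=> [sn K|h].
  have [p ap] := lang_alpha (sn K); exists p.
  by have := starts_agree (starts_mkseq s K) ap; rewrite size_mkseq.
apply: admissible_agree => K; have [p sp] := h K; exists (iter p shift (alpha n)).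
by split=> //; apply: admissible_shift; exact: admissible_alpha.
Qed.

End Alpha.

Lemma alpha_LambdaS n : (forall i, 0 < n i) ->
  alpha n = LambdaS (n 0) (alpha (tail n)).
Proof.
move=> n0; symmetry; apply: starts_alpha => // -[|k].
  exists (shift (LambdaS (n 0) (alpha (tail n)))).
  by rewrite -[LHS]scons_shift LambdaS_eq alpha0 // => i; exact: n0.
have [z ->] := alpha_starts (tail n) k.
by rewrite LambdaS_scat Lam_tail; eexists.
Qed.

(** The pair 31 occurs in the block of 3, and the images of 31, 12, 23 contain 12, 23, 13
    respectively. Each step uses one more level of [n]. The pairs 13 and 23 are the junctions at the
    point of [t_seq] and [t_hat]. *)
Lemma lang13 n : (forall i, 0 < n i) -> lang n [:: L1; L3].
Proof.
have h31 m : (forall i, 0 < m i) -> lang m [:: L3; L1].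
  move=> m0; exists 1; rewrite -[Lam _ _ _]/(Lambda_word (m 0) [:: L3]) Lambda_word1 /=.
  by case: (m 0) (m0 0) => // k _; exact: (prefix_infix [:: L3; L1]).
have hS m w w' : (forall i, 0 < m i) -> infix w' (Lambda_word (m 0) w) ->
    lang (tail m) w -> lang m w'.
  by move=> m0 ww' wm; apply: lang_infix ww' _; exact: (@lang_Lam m 1).
have h12 m : (forall i, 0 < m i) -> lang m [:: L1; L2].
  move=> m0; apply: (hS _ [:: L3; L1]) (h31 _ _) => // [|i]; last exact: m0.
  case: (m 0) (m0 0) => // k _.
  have -> : Lambda_word k.+1 [:: L3; L1] = L3 :: nseq k.+1 L1 ++ [:: L2] by [].
  by rewrite nseqSr -catA; exact: (suffix_infix (L3 :: nseq k L1)).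
have h23 m : (forall i, 0 < m i) -> lang m [:: L2; L3].
  move=> m0; apply: (hS _ [:: L1; L2]) (h12 _ _) => // [|i]; last exact: m0.
  exact: (prefix_infix [:: L2; L3]).
move=> n0; apply: (hS _ [:: L2; L3]) (h23 _ _) => // [|i]; last exact: n0.
have -> : Lambda_word (n 0) [:: L2; L3] = L3 :: nseq (n 0).+1 L1 ++ L3 :: nseq (n 0) L1.
  by rewrite /Lambda_word /= cats0.
by rewrite nseqSr -catA -cat_cons; exact: (infix_infix (L3 :: nseq (n 0) L1) [:: L1; L3]).
Qed.

Lemma lang23 n : (forall i, 0 < n i) -> lang n [:: L2; L3].
Proof.
move=> n0; have /lang13 : forall i, 0 < tail n i by move=> i; exact: n0.
move=> /(@lang_Lam n 1); apply: lang_infix; exact: (prefix_infix [:: L2; L3]).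
Qed.

Lemma lang1 n a : (forall i, 0 < n i) -> lang n [:: a].
Proof.
move=> n0; case: a.
- by apply: lang_infix (lang13 n0); exact: (prefix_infix _ [:: L3]).
- by apply: lang_infix (lang23 n0); exact: (prefix_infix _ [:: L3]).
- by apply: lang_infix (lang23 n0); exact: (suffix_infix [:: L2]).
Qed.

(* [desub m s (u, a, v) x]: the letter [a] at the point of [s] lies in the block
   [u a v = Lambda m (x 0)], and [s = a v Lambda m (x 1) Lambda m (x 2) ...]. *)
Definition desub (m : nat) (s : oneseq) (e : edge) (x : oneseq) :=
  Lambda m (x 0) = eu e ++ ea e :: ev e /\
  s = scat (ea e :: ev e) (LambdaS m (shift x)).

Lemma desub_head m s e x : desub m s e x -> s 0 = ea e.
Proof. by case=> _ ->. Qed.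

(** The letter 2 occurs only in the block of 1. The other blocks are a 3 followed by ones, so [v] is
    the full run of ones exactly when the point sits at the 3. *)
Lemma Lambda_split m b u a v : Lambda m b = u ++ a :: v ->
  v = nseq (size v) L1 /\ ((a = L2 /\ b = L1) \/ (a <> L2 /\ b <> L1 /\
   let k := if b is L2 then m.+1 else m in if a is L3 then size v = k else size v < k)).
Proof.
have ones j w c z : nseq j L1 = w ++ c :: z -> [/\ c = L1, z = nseq (size z) L1 & size z < j].
  elim: j w => [|j IH] [|d w] //= [].
    by move=> -> <-; rewrite size_nseq.
  by move=> _ /IH[? ? ?]; split=> //; rewrite ltnW.
case: b => /=; case: u => [|d u] /= [].
- by move=> <- <-; split=> //; left.
- by case: u.
- by move=> <- <-; rewrite /= !size_nseq; split=> //; right.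
- by move=> _ /(@ones m.+1)[-> ? h]; split=> //; right.
- by move=> <- <-; rewrite /= !size_nseq; split=> //; right.
- by move=> _ /(@ones m)[-> ? h]; split=> //; right.
Qed.

(** Quantitative recognizability. The part [a v] takes at most [m.+2] letters and shows the run of
    ones up to its end; the remaining letters cover the next [L] blocks through [agree_LambdaS]. *)
Lemma desub_agree m L s s' e e' x x' : ok (x 0) (x 1) -> ok (x' 0) (x' 1) ->
  desub m s e x -> desub m s' e' x' -> agree (m.+3 * L.+1) s s' ->
  e = e' /\ agree L x x'.
Proof.
case: e e' => [[u a] v] [[u' a'] v'] okx okx' [/= E ->] [/= E' ->].
rewrite /eu /ea /ev /= in E E' * => h.
have [av bcase] := Lambda_split E; have [av' bcase'] := Lambda_split E'.
have svm : size v < m.+2.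
  by have := size_Lambda_le m (x 0); rewrite E size_cat /=; lia.
have svm' : size v' < m.+2.
  by have := size_Lambda_le m (x' 0); rewrite E' size_cat /=; lia.
have KL : (m.+3 * L + m.+2).+1 <= m.+3 * L.+1 by rewrite mulnS; lia.
have /agree_scons[aa {}h] := agreeW KL h.
rewrite av av' in h.
have [||||vv {}h] := agree_ones _ _ _ _ h; try exact: LambdaS_head; try lia.
(* The letter right after the run [v] begins the next block. *)
have z0 : x 1 = L1 <-> x' 1 = L1.
  have {}h : LambdaS m (shift x) 0 = LambdaS m (shift x') 0 by apply: h; lia.
  have := @LambdaS_head2 m (shift x); have := @LambdaS_head2 m (shift x').
  by rewrite h => -> ->.
have bb : x 0 = x' 0.
  (* If neither block is that of 1, then [ok] decides between 2 and 3 by whether 1 comes next. *)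
  rewrite -aa in bcase'; case: bcase bcase' => [[a2 ->]|[a2 [b1 _]]] [[a2' ->]|[a2' [b1' _]]] //.
  move: okx okx' b1 b1'; rewrite /ok; case: z0.
  by case: (x 0) (x' 0) (x 1) (x' 1) => [] [] [] [] // h1 h2; first [have := h1 erefl | have := h2 erefl].
(* The blocks coincide and so do their suffixes [a v], so cancellation gives [u]. *)
have uu : u = u'.
  have /eqP := E; rewrite bb E' aa eqseq_cat; first by case/andP => /eqP.
  have := congr1 size E; rewrite bb E' !size_cat /= vv; lia.
have vv' : v = v' by rewrite av av' vv.
split; first by rewrite uu aa vv'.
case: L {KL} h => [//|L] h [|i] // iL.
apply: (@agree_LambdaS m L (shift x) (shift x')) => //.
by apply: agreeW h; rewrite mulnS; lia.
Qed.

Lemma desub_uniq m s e e' x x' : ok (x 0) (x 1) -> ok (x' 0) (x' 1) ->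
  desub m s e x -> desub m s e' x' -> e = e' /\ x = x'.
Proof.
move=> okx okx' h h'; split.
  by have [] := @desub_agree m 0 _ _ _ _ _ _ okx okx' h h'.
apply/funext => i.
by have [_] := @desub_agree m i.+1 _ _ _ _ _ _ okx okx' h h' (fun _ _ => erefl); apply.
Qed.

(** The point moves one place at a time, inside its block while [v] is nonempty and into the next
    block otherwise. The count of letters to the left of the point is recorded for
    [alpha_aperiodic]. *)
Lemma desub_LambdaS m y j : exists i e,
  desub m (iter j shift (LambdaS m y)) e (iter i shift y) /\
  size (Lambda_word m (mkseq y i)) + size (eu e) = j.
Proof.
elim: j => [|j [i [[[u a] v] [[/= E sE] jE]]]].
  exists 0, ([::], head L1 (Lambda m (y 0)), behead (Lambda m (y 0))).
  by split=> //; split; rewrite /= ?(LambdaS_eq m y); case: (y 0).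
rewrite /eu /ea /ev /= in E sE jE.
case: v E sE => [|b v] E sE.
  exists i.+1, ([::], head L1 (Lambda m (y i.+1)), behead (Lambda m (y i.+1))).
  split; first split.
  - by rewrite iter_shiftE; case: (y _).
  - rewrite iterS sE /= -[LHS]/(LambdaS m (shift (iter i shift y))) LambdaS_eq.
    by rewrite -iterS iter_shiftE; case: (y _).
  - rewrite -jE mkseqS -cats1 Lambda_word_cat Lambda_word1 size_cat.
    by have := congr1 size E; rewrite iter_shiftE add0n size_cat /= => ->; lia.
exists i, (u ++ [:: a], b, v); split; first split.
- by rewrite /eu /ea /ev /= E -catA.
- by rewrite /= sE.
- by rewrite -jE /eu /= size_cat /=; lia.
Qed.

(** * Iterated desubstitution and paths *)

Lemma LambdaS_starts m s w : starts s w -> starts (LambdaS m s) (Lambda_word m w).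
Proof. by case=> z ->; rewrite LambdaS_scat; eexists. Qed.

(** Shifts of alpha that approximate [s] can be desubstituted by [desub_LambdaS]. By [desub_agree]
    their edges are constant and their preimages converge, which replaces an appeal to
    compactness. *)
Lemma desub_exists n s : (forall i, 0 < n i) -> admissible n s ->
  exists e x, admissible (tail n) x /\ desub (n 0) s e x.
Proof.
move=> n0 /(admissibleP n0) sn; pose m := n 0; pose M L := m.+3 * L.+1.
have tn0 : forall i, 0 < tail n i by move=> i; exact: n0.
have /choice[F HF] : forall L, exists r : oneseq * edge * oneseq,
    [/\ admissible (tail n) r.2, desub m r.1.1 r.1.2 r.2 & agree (M L) s r.1.1].
  move=> L; have [p sp] := sn (M L).
  have [i [e [dp _]]] := desub_LambdaS m (alpha (tail n)) p.
  exists (iter p shift (alpha n), e, iter i shift (alpha (tail n))); split=> //=.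
    exact/admissible_shift/admissible_alpha.
  by rewrite (alpha_LambdaS n0).
pose e L := (F L).1.2; pose xs L := (F L).2.
have FF L L' : L <= L' -> e L = e L' /\ agree L (xs L) (xs L').
  move=> LL; have [xL dL sL] := HF L; have [xL' dL' sL'] := HF L'.
  apply: desub_agree dL dL' _; try exact: admissible_ok tn0 _.
  move=> i iM; rewrite -sL // sL' //; apply: leq_trans iM _.
  by rewrite leq_mul2l ltnS LL orbT.
(* The limit is taken diagonally: [xs i.+1] is already final at place [i]. *)
pose x : oneseq := fun i => xs i.+1 i.
have xxs L : agree L x (xs L) by move=> i iL; exact: (FF _ _ iL).2.
exists (e 0), x; split.
  by apply: admissible_agree => K; exists (xs K); split=> //; have [] := HF K.
split.
  by have [_ [E _] _] := HF 1; rewrite (FF 0 1 isT).1.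
apply: starts_eq => L; pose w := ea (e 0) :: ev (e 0) ++ Lambda_word m (mkseq (shift x) L).
exists w; split.
- have := size_Lambda_word m (mkseq (shift x) L); rewrite size_mkseq /= size_cat; lia.
(* Approximation [L.+1] is used so that [w] fits into the letters shared with [s] and the first [L]
   letters of [shift x] are final. *)
- have [_ [E yE] sy] := HF L.+1; have eE := (FF 0 L.+1 isT).1.
  apply: (@agree_starts (F L.+1).1.1).
    move=> i iw; symmetry; apply: sy; apply: leq_trans iw _.
    have := size_Lambda_le m ((F L.+1).2 0); rewrite E -/(e _) -eE size_cat /= size_cat.
    have := size_Lambda_word_le m (mkseq (shift x) L); rewrite size_mkseq /M !mulnS.
    nia.
  rewrite /w; have -> : mkseq (shift x) L = mkseq (shift (xs L.+1)) L.
    by apply: agree_mkseq => i iL; exact: xxs.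
  rewrite yE -/(e L.+1) -eE.
  have [z zE] := LambdaS_starts m (starts_mkseq (shift (xs L.+1)) L).
  by exists z; rewrite /xs in zE *; rewrite zE -scat_cat.
- have [z ->] := LambdaS_starts m (starts_mkseq (shift x) L).
  by exists z; rewrite -scat_cat.
Qed.

Definition levels (n : nat -> nat) (G : nat -> edge) (x : nat -> oneseq) :=
  forall i, admissible (iter i (@tail nat) n) (x i) /\ desub (n i) (x i) (G i) (x i.+1).

(** This relation turns out to be the graph of [Hmap] ([codes_Hmap]). [codes_exists] gives
    surjectivity, [codes_agree] injectivity and a continuous inverse, [codes_prefix] continuity. *)
Definition codes n G s := exists2 x, x 0 = s & levels n G x.

Lemma codes_exists n s : (forall i, 0 < n i) -> admissible n s ->
  exists2 G, is_path n G & codes n G s.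
Proof.
move=> n0 sn; pose nn i := iter i (@tail nat) n.
have /choice[F HF] : forall r : nat * oneseq, exists ex : edge * oneseq,
    admissible (nn r.1) r.2 -> admissible (nn r.1.+1) ex.2 /\ desub (n r.1) r.2 ex.1 ex.2.
  (* On a sequence that is not admissible the value is an arbitrary default. *)
  case=> i y; case: (pselect (admissible (nn i) y)) => [yi|?]; last first.
    by exists (([::], L1, [::]), y).
  have [|e [x [xi d]]] := desub_exists _ yi; first by move=> j; rewrite /nn iter_tailE.
  by exists (e, x) => _; split=> //; move: d; rewrite /nn iter_tailE.
pose x := fix x i := if i is j.+1 then (F (j, x j)).2 else s.
have xn i : admissible (nn i) (x i).
  by elim: i => // i IH; have [] := HF (i, x i) IH.
have lx : levels n (fun i => (F (i, x i)).1) x.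
  by move=> i; split; [exact: xn | exact: (HF (i, x i) (xn i)).2].
exists (fun i => (F (i, x i)).1); last by exists x.
by move=> i; have [E _] := (lx i).2; rewrite -E (desub_head (lx i.+1).2).
Qed.

(** The modulus of [desub_agree] is composed [i] times. [M] is chosen before the paths and the
    sequences, so it is uniform. *)
Lemma levels_agree n i L : (forall i, 0 < n i) -> exists M, forall G G' x x',
  levels n G x -> levels n G' x' -> agree M (x 0) (x' 0) -> agree L (x i) (x' i).
Proof.
move=> n0; elim: i L => [|i IH] L; first by exists L.
have [M HM] := IH ((n i).+3 * L.+1); exists M => G G' x x' lx lx' /(HM _ _ _ _ lx lx') h.
have ok_lx G0 x0 : levels n G0 x0 -> ok (x0 i.+1 0) (x0 i.+1 1).
  by move=> l; apply: admissible_ok (l i.+1).1 => j; rewrite iter_tailE.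
by have [] := desub_agree (ok_lx _ _ lx) (ok_lx _ _ lx') (lx i).2 (lx' i).2 h.
Qed.

Lemma codes_agree n N : (forall i, 0 < n i) -> exists M, forall G G' s s',
  codes n G s -> codes n G' s' -> agree M s s' -> forall i, i <= N -> G i = G' i.
Proof.
move=> n0; have H i : exists M, forall G G' s s',
    codes n G s -> codes n G' s' -> agree M s s' -> G i = G' i.
  have [M HM] := levels_agree i (n i).+3 n0; exists M.
  move=> G G' s s' [x <- lx] [x' <- lx'] /(HM _ _ _ _ lx lx') h.
  have ok_lx G0 x0 : levels n G0 x0 -> ok (x0 i.+1 0) (x0 i.+1 1).
    by move=> l; apply: admissible_ok (l i.+1).1 => j; rewrite iter_tailE.
  have [|] := @desub_agree _ 0 _ _ _ _ _ _ (ok_lx _ _ lx) (ok_lx _ _ lx') (lx i).2 (lx' i).2 => //.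
  by rewrite muln1.
elim: N => [|N [M HM]].
  have [M HM] := H 0; exists M => G G' s s' c c' h i; rewrite leqn0 => /eqP ->; exact: HM c c' h.
have [M' HM'] := H N.+1; exists (maxn M M') => G G' s s' c c' h i.
rewrite leq_eqVlt => /predU1P[->|].
  by apply: HM' c c' _; apply: agreeW h; exact: leq_maxr.
by rewrite ltnS; apply: HM c c' _ _; apply: agreeW h; exact: leq_maxl.
Qed.

Fixpoint LamS (n : nat -> nat) (k : nat) (s : oneseq) : oneseq :=
  if k is k'.+1 then LamS n k' (LambdaS (n k') s) else s.

Lemma LamS_scat n k w s : LamS n k (scat w s) = scat (Lam n k w) (LamS n k s).
Proof. by elim: k w s => //= k IH w s; rewrite LambdaS_scat IH. Qed.

Definition right_word (n : nat -> nat) (G : nat -> edge) (k : nat) : word :=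
  ea (G 0) :: flatten (mkseq (fun i => Lam n i (ev (G i))) k).

Lemma right_wordS n G k : right_word n G k.+1 = right_word n G k ++ Lam n k (ev (G k)).
Proof. by rewrite /right_word mkseqS flatten_rcons. Qed.

(** For paths these are the tail classes of [gamma_beta] and [gamma_hbeta], by
    [right_finite_edges]. *)
Definition right_finite (G : nat -> edge) := exists K, forall i, K <= i -> ev (G i) = [::].

Lemma right_word_const n G K k :
  (forall i, K <= i -> ev (G i) = [::]) -> K <= k -> right_word n G k = right_word n G K.
Proof.
move=> GK Kk; rewrite -(subnKC Kk); elim: (k - K) => [|d IH]; first by rewrite addn0.
rewrite addnS right_wordS GK ?leq_addr // IH.
suff -> : Lam n (K + d) [::] = [::] by rewrite cats0.
by elim: (K + d).
Qed.

Lemma right_word_unbounded n G L : ~ right_finite G -> exists k, L <= size (right_word n G k).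
Proof.
move=> Gf; elim: L => [|L [k kL]]; first by exists 0.
have [i ki Gi] : exists2 i, k <= i & ev (G i) != [::].
  by apply: contrapT => h; apply: Gf; exists k => i ki; apply/eqP/negPn/negP => ?; apply: h; exists i.
exists i.+1; rewrite right_wordS size_cat -addn1; apply: leq_add; last first.
  by rewrite lt0n size_eq0 Lam_neq0.
apply: leq_trans kL _; rewrite -(subnKC ki); elim: (i - k) => [|d IH]; first by rewrite addn0.
by rewrite addnS right_wordS size_cat (leq_trans IH) ?leq_addr.
Qed.

Lemma levels_scat n G x k : levels n G x ->
  x 0 = scat (right_word n G k) (LamS n k (shift (x k))).
Proof.
move=> lx; elim: k => [|k ->]; first by rewrite /= -(desub_head (lx 0).2) scons_shift.
by rewrite right_wordS scat_cat /= -LamS_scat {1}(lx k).2.2.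
Qed.

(** An empty [v] puts the point at the end of a block. As [n i] is positive no block ends in 3, and
    only the block of 1 ends in 2. *)
Lemma path_last n G i : (forall i, 0 < n i) -> is_path n G -> ev (G i) = [::] ->
  ea (G i) <> L3 /\ (ea (G i) = L2 -> ea (G i.+1) = L1).
Proof.
move=> n0 /(_ i) /Lambda_split[_ h] v0; rewrite v0 in h.
case: h => [[-> ->] //|[a2 [_ h]]]; split=> // a3; rewrite a3 in h.
by have := n0 i; case: (ea (G i.+1)) h => /= h; lia.
Qed.

(* When every [v i] with [i >= K] is empty, the letters [a i] alternate between
   [1] and [2] and the sequence continues with [Lam n k [:: L3]] after
   [right_word n G K] for arbitrarily large [k]. *)
Lemma codes_prefix n G L : (forall i, 0 < n i) -> is_path n G ->
  exists N q, L <= size q /\ forall G' s', codes n G' s' ->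
    (forall i, i <= N -> G' i = G i) -> starts s' q.
Proof.
move=> n0 Gp; have rw G' k N : k <= N -> (forall i, i <= N -> G' i = G i) ->
    right_word n G' k = right_word n G k.
  move=> kN GG; rewrite /right_word GG //; congr (_ :: flatten _).
  apply/eq_in_map => i; rewrite mem_iota add0n => /= ik; rewrite GG //.
  exact: leq_trans (ltnW ik) kN.
case: (pselect (right_finite G)) => [[K GK]|Gf]; last first.
  have [N LN] := right_word_unbounded n L Gf; exists N, (right_word n G N); split=> //.
  move=> G' s' [x <- lx] GG; rewrite (levels_scat N lx) (rw _ _ N) //.
  by eexists.
have [k [KLk ak]] : exists k, maxn K L <= k /\ ea (G k) = L1.
  have [a3 a2] := path_last n0 Gp (GK _ (leq_maxl K L)).
  case E : (ea (G (maxn K L))) => //; first by exists (maxn K L).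
  by exists (maxn K L).+1; rewrite a2.
have Kk : K <= k by apply: leq_trans KLk; exact: leq_maxl.
exists k.+1, (right_word n G k ++ Lam n k [:: L3]); split.
  rewrite size_cat; apply: leq_trans (leq_addl _ _).
  apply: leq_trans (ltnW (size_Lam3 n0 k)); apply: leq_trans KLk; exact: leq_maxr.
move=> G' s' [x <- lx] GG; rewrite (levels_scat k lx) (rw _ _ k.+1) //.
have ok1 : ok (x k.+1 0) (x k.+1 1).
  by apply: admissible_ok (lx k.+1).1 => j; rewrite iter_tailE.
(* The block containing the letter 1 is not that of 1, and 3 is excluded by [path_last] at level
   [k.+1]. This is why [N] is [k.+1]. *)
have b2 : x k.+1 0 = L2.
  have [E _] := (lx k).2; have [_] := Lambda_split E.
  rewrite GG // ak => -[[]|[_ [+ _]]] //.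
  have [+ _] := path_last n0 Gp (GK _ (leqW Kk)).
  by rewrite -(GG k.+1) // -(desub_head (lx k.+1).2); case: (x k.+1 0).
(* After the 2 that begins [x k.+1] no 1 can follow, so the next block begins with 3. *)
have c3 : shift (x k) 0 = L3.
  rewrite (lx k).2.2 GG // GK //= -[LHS]/(LambdaS (n k) (shift (x k.+1)) 0).
  have := @LambdaS_head (n k) (shift (x k.+1)); have [+ _] := @LambdaS_head2 (n k) (shift (x k.+1)).
  case: (LambdaS _ _ 0) => // /(_ erefl) E; move: ok1; rewrite b2 -[x _ 1]/(shift (x k.+1) 0) E //.
rewrite -(scons_shift (shift (x k))) c3 -[scons _ _]/(scat [:: L3] _) LamS_scat.
by eexists; rewrite scat_cat.
Qed.

Lemma codes_inj n G s s' : (forall i, 0 < n i) -> is_path n G ->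
  codes n G s -> codes n G s' -> s = s'.
Proof.
move=> n0 Gp c c'; apply: starts_eq => L; have [N [q [Lq h]]] := codes_prefix L n0 Gp.
by exists q; split=> //; [apply: h c _ | apply: h c' _].
Qed.

(** * Sequences with two predecessors, and aperiodicity of alpha *)

Definition two_preds n s :=
  exists a b, [/\ a <> b, admissible n (scons a s) & admissible n (scons b s)].

(** Both extensions are desubstituted at their first letter. If [s] begins with 1, both points lie
    inside blocks, and uniqueness for [s] forces [a = b]. Otherwise both points end their blocks,
    [s] is an image, and the two blocks differ in their last letter. *)
Lemma two_preds_desub n s : (forall i, 0 < n i) -> two_preds n s ->
  exists2 s', s = LambdaS (n 0) s' & two_preds (tail n) s'.
Proof.
move=> n0 [a [b [ab sa sb]]].
have tn0 : forall i, 0 < tail n i by move=> i; exact: n0.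
have [[[u a'] v] [x [xn d]]] := desub_exists n0 sa.
have [[[u' b'] v'] [x' [xn' d']]] := desub_exists n0 sb.
have := desub_head d; have := desub_head d'; rewrite /ea /= => ? ?.
subst a' b'; case: d => E sE; case: d' => E' sE'.
rewrite /eu /ea /ev /= in E E' sE sE'.
have {}sE := congr1 shift sE; have {}sE' := congr1 shift sE'.
have {}sE : s = scat v (LambdaS (n 0) (shift x)) by [].
have {}sE' : s = scat v' (LambdaS (n 0) (shift x')) by [].
have ones : forall w y, s = scat w (LambdaS (n 0) y) -> w = nseq (size w) L1 ->
    (w == [::]) = (s 0 != L1).
  by move=> [|c w] y -> /=; [move=> _; symmetry; apply/eqP/LambdaS_head | case=> -> _; rewrite eqxx].
have [v1 _] := Lambda_split E; have [v1' _] := Lambda_split E'.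
(* Whether the rest of the block is empty is visible on [s] alone. *)
have vv : (v == [::]) = (v' == [::]).
  by rewrite (ones _ _ sE v1) (ones _ _ sE' v1').
case: v v' vv E E' sE sE' v1 v1' => [|c v] [|c' v'] // _ E E' sE sE'.
  move=> _ _; exists (shift x) => //; exists (x 0), (x' 0).
  have x'x : shift x' = shift x by apply: (@LambdaS_inj (n 0)); rewrite -[LHS]sE' -[RHS]sE.
  rewrite -{2}x'x !scons_shift; split=> // xx; apply: ab.
  by move: E; rewrite xx E' !cats1 => /rcons_inj[].
move=> [c1 _] [c1' _]; exfalso; apply: ab.
have d : desub (n 0) s (u ++ [:: a], c, v) x by split=> //; rewrite E /eu /= -catA.
have d' : desub (n 0) s (u' ++ [:: b], c', v') x' by split=> //; rewrite E' /eu /= -catA.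
have [] := desub_uniq (admissible_ok tn0 xn) (admissible_ok tn0 xn') d d'.
by case=> + _ _ _; rewrite !cats1 => /rcons_inj[].
Qed.

Lemma two_preds_alpha n s : (forall i, 0 < n i) -> two_preds n s -> s = alpha n.
Proof.
move=> n0 sn; have H1 m y : (forall i, 0 < m i) -> two_preds m y -> y 0 <> L1.
  by move=> m0 /(two_preds_desub m0)[y' -> _]; exact: LambdaS_head.
have H3 m y : (forall i, 0 < m i) -> two_preds m y -> y 0 = L3.
  move=> m0 ym; have := H1 _ _ m0 ym; have [y' yE] := two_preds_desub m0 ym.
  (* The preimage does not begin with 1 either, so its image cannot begin with 2. *)
  move=> /H1 h; have {h} : y' 0 <> L1 by apply: h => i; exact: m0.
  rewrite yE => h; have [+ _] := LambdaS_head2 (m 0) y'.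
  by case: (LambdaS _ _ 0) => // /(_ erefl).
apply: starts_alpha => // k; elim: k n n0 s sn => [|k IH] n n0 s sn.
  by exists (shift s); rewrite -[LHS]scons_shift (H3 n).
have [s' -> sn'] := two_preds_desub n0 sn; rewrite Lam_tail; apply: LambdaS_starts.
by apply: IH => // i; exact: n0.
Qed.

(** By uniqueness of desubstitution a period of alpha ends at a block boundary and comes from a
    period of [alpha (tail n)]. That one is shorter, because the first block, that of 3, has at
    least two letters. *)
Lemma alpha_aperiodic n j : (forall i, 0 < n i) -> 0 < j -> iter j shift (alpha n) <> alpha n.
Proof.
elim/ltn_ind: j n => j IH n n0 j0 E.
have tn0 : forall i, 0 < tail n i by move=> i; exact: n0.
have [i [e [d sz]]] := desub_LambdaS (n 0) (alpha (tail n)) j.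
rewrite -alpha_LambdaS // E in d.
have d' : desub (n 0) (alpha n) ([::], L3, nseq (n 0) L1) (alpha (tail n)).
  by split; [rewrite alpha0 | rewrite {1}alpha_LambdaS // LambdaS_eq alpha0].
have ok_i k : ok (iter k shift (alpha (tail n)) 0) (iter k shift (alpha (tail n)) 1).
  exact/(admissible_ok tn0)/admissible_shift/admissible_alpha.
have [eE iE] := desub_uniq (ok_i i) (ok_i 0) d d'.
rewrite eE /= addn0 in sz.
case: i iE sz {d} => [|i] iE sz; first by rewrite -sz in j0.
apply: (IH i.+1 _ (tail n)) => //; rewrite -sz.
have -> : mkseq (alpha (tail n)) i.+1 = [:: L3] ++ mkseq (shift (alpha (tail n))) i.
  by rewrite -(alpha0 (tail n)) -add1n mkseqD.
rewrite Lambda_word_cat Lambda_word1 size_cat /= size_nseq.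
have := size_Lambda_word (n 0) (mkseq (shift (alpha (tail n))) i).
by rewrite size_mkseq; have := n0 0; lia.
Qed.

(** * The map H *)

Definition left_word (n : nat -> nat) (G : nat -> edge) (k : nat) : word :=
  flatten (rev (mkseq (fun i => Lam n i (eu (G i))) k)).

Lemma left_wordS n G k : left_word n G k.+1 = Lam n k (eu (G k)) ++ left_word n G k.
Proof. by rewrite /left_word mkseqS rev_rcons. Qed.

Lemma left_right_word n G k : is_path n G ->
  left_word n G k ++ right_word n G k = Lam n k [:: ea (G k)].
Proof.
move=> Gp; elim: k => // k IH; rewrite left_wordS right_wordS.
rewrite -catA [left_word n G k ++ _]catA IH -!Lam_cat /=.
by rewrite Lambda_word1 Gp.
Qed.

Lemma rlim_right n G p :
  (forall k, p < size (right_word n G k) ->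
     rlim (right_word n G) p = Some (nth L1 (right_word n G k) p)) /\
  ((forall k, size (right_word n G k) <= p) -> rlim (right_word n G) p = None).
Proof. by apply: rlim_prefix => k; rewrite right_wordS prefix_prefix. Qed.

Lemma llim_left n G q :
  (forall k, q < size (left_word n G k) ->
     llim (left_word n G) q = Some (nth L1 (rev (left_word n G k)) q)) /\
  ((forall k, size (left_word n G k) <= q) -> llim (left_word n G) q = None).
Proof.
have [|h1 h2] := @rlim_prefix (rev \o left_word n G) q.
  by move=> k; rewrite /= left_wordS rev_cat prefix_prefix.
by split=> [k qk|h]; [apply: h1; rewrite /= size_rev | apply: h2 => k; rewrite /= size_rev].
Qed.

(* [lseq n L1] and [lseq n L2] are the left infinite sequences [obeta n] and
   [ohbeta n]. *)
Definition lseq (n : nat -> nat) (b : letter) : oseq := llim (fun k => Lam n k.*2 [:: b]).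

(** [b = L1] gives [t_seq] and [b = L2] gives [t_hat], so that both are treated at once. *)
Definition biseq_of (n : nat -> nat) (b : letter) : biseq :=
  strip (pjoin (lseq n b) (oalpha n)).

Section LeftLimit.
Variables (n : nat -> nat) (b : letter).
Hypothesis b3 : b <> L3.

(** Two substitutions turn 1 into a word ending in 1 and 2 into a word ending in 2. This is why the
    left infinite limits run over even levels. *)
Lemma Lam_double k :
  exists2 w, w != [::] & Lam n k.+1.*2 [:: b] = Lam n k.*2 w ++ Lam n k.*2 [:: b].
Proof.
have -> : Lam n k.+1.*2 [:: b] =
  Lam n k.*2 (Lambda_word (n k.*2) (Lambda_word (n k.*2.+1) [:: b])) by [].
rewrite Lambda_word1; case: b b3 => // _ /=.
  rewrite Lambda_word1 /= -[L1 :: nseq _ _]/(nseq (n k.*2).+1 L1) nseqSr -cat_cons Lam_cat.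
  by eexists; last reflexivity.
rewrite -[L1 :: nseq _ _]/(nseq (n k.*2.+1).+1 L1) nseqSr -cat_cons Lambda_word_cat Lam_cat.
by eexists; last reflexivity.
Qed.

Lemma size_Lam_double k : k < size (Lam n k.*2 [:: b]).
Proof.
elim: k => // k IH; have [w w0 ->] := Lam_double k; rewrite size_cat -add1n.
by apply: leq_add => //; rewrite lt0n size_eq0 Lam_neq0.
Qed.

Lemma lseq_nth k i : i < size (Lam n k.*2 [:: b]) ->
  lseq n b i = Some (nth L1 (rev (Lam n k.*2 [:: b])) i).
Proof.
have [|h1 _ ik] := @rlim_prefix (rev \o (fun k => Lam n k.*2 [:: b])) i.
  move=> j; have [w _ E] := Lam_double j.
  by rewrite -[(_ \o _) j.+1]/(rev (Lam n j.+1.*2 [:: b])) E rev_cat prefix_prefix.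
by apply: h1; rewrite /= size_rev.
Qed.

Lemma lseq_some i : lseq n b i <> None.
Proof. by rewrite (@lseq_nth i) // size_Lam_double. Qed.

Lemma biseq_of_nth k i : i < size (Lam n k.*2 [:: b]) ->
  biseq_of n b (Negz i) = nth L1 (rev (Lam n k.*2 [:: b])) i.
Proof. by move=> ik; rewrite /biseq_of /strip /= (lseq_nth ik). Qed.

End LeftLimit.

Lemma exponentE (D : set int) (x y : int -> option letter) (j : int) :
  D j -> x = shiftz j y -> (forall j', D j' -> shiftz j y = shiftz j' y -> j' = j) ->
  exponent D x y = j.
Proof.
move=> Dj xy h; rewrite /exponent; apply: xget_unique; first by split.
by move=> j' [Dj' xy']; apply: h => //; rewrite -xy.
Qed.

Section HmapCases.
Variables (n : nat -> nat) (G : nat -> edge).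
Hypothesis n0 : forall i, 0 < n i.
Hypothesis Gp : is_path n G.

Lemma size_right_word_le k k' : k <= k' -> size (right_word n G k) <= size (right_word n G k').
Proof.
move=> /subnKC <-; elim: (k' - k) => [|d IH]; first by rewrite addn0.
by rewrite addnS right_wordS size_cat (leq_trans IH) ?leq_addr.
Qed.

(** From level [K] on the right word is frozen. By [left_right_word] at even levels, left and right
    word together form [Lam n k.*2 [:: b]], so the point lies [m] places before the end of
    [lseq n b]. *)
Lemma W_finite_right K b : b <> L3 ->
    (forall i, K <= i -> ev (G i) = [::]) ->
    (forall i, K <= i -> ~~ odd i -> ea (G i) = b) ->
  let m := size (right_word n G K) in
  W n G = shiftz (- m%:Z)%R (pjoin (lseq n b) eps) /\
  (forall p, p < m -> lseq n b (m - p.+1) = Some (nth L1 (right_word n G K) p)).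
Proof.
move=> b3 GK Gb m.
have w k : K <= k.*2 -> Lam n k.*2 [:: b] = left_word n G k.*2 ++ right_word n G K.
  by move=> Kk; rewrite -(right_word_const n GK Kk) left_right_word // Gb ?odd_double.
have lm p : p < m -> lseq n b (m - p.+1) = Some (nth L1 (right_word n G K) p).
  move=> pm; have KK : K <= K.*2 by rewrite -addnn leq_addr.
  rewrite (@lseq_nth _ _ b3 K) w // ?size_cat -/m; last by lia.
  rewrite rev_cat nth_cat size_rev -/m ifT; last by lia.
  by rewrite nth_rev -/m; [congr (Some (nth _ _ _)); lia | lia].
split=> //; apply/funext => -[p|q]; rewrite /shiftz.
  have [r1 r2] := rlim_right n G p; rewrite /W /=.
  case: (ltnP p m) => pm.
    have -> : (p%:Z - m%:Z)%R = Negz (m - p.+1) by lia.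
    by rewrite [RHS]lm //; apply: r1.
  have -> : (p%:Z - m%:Z)%R = Posz (p - m) by lia.
  rewrite [RHS]/(eps _); apply: r2 => k; apply: leq_trans pm.
  case: (leqP K k) => Kk; first by rewrite (right_word_const n GK Kk).
  exact/size_right_word_le/ltnW.
have -> : (Negz q - m%:Z)%R = Negz (q + m) by lia.
pose k := K + (q + m); have Kk : K <= k.*2 by rewrite -addnn; lia.
have kk : q + m < size (Lam n k.*2 [:: b]).
  by apply: leq_trans (size_Lam_double n b3 k); rewrite ltnS leq_addl.
rewrite /= (lseq_nth b3 kk); move: kk; rewrite w // size_cat -/m ltn_add2r => qk.
rewrite rev_cat nth_cat size_rev -/m ltnNge leq_addl /= addnK.
by have [l1 _] := llim_left n G q; exact: l1.
Qed.

Lemma Hmap_finite_right K b : b <> L3 ->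
    (forall i, K <= i -> ev (G i) = [::]) ->
    (forall i, K <= i -> ~~ odd i -> ea (G i) = b) ->
  proj_right (shiftz (exponent [set j | (j < 0)%R] (W n G) (pjoin (lseq n b) eps))
    (biseq_of n b)) = scat (right_word n G K) (alpha n).
Proof.
move=> b3 GK Gb; have [WE lE] := W_finite_right b3 GK Gb.
set m := size _ in WE lE; have m0 : 0 < m by [].
have none i : (pjoin (lseq n b) eps i = None) <-> (0 <= i)%R.
  case: i => i; split=> //=; first by move/(lseq_some b3).
rewrite (exponentE _ WE); last first.
- move=> j' _ E0; set y := pjoin _ _ in E0 none.
  have E i : y (i - m%:Z)%R = y (i + j')%R by have := congr1 (fun f : int -> option letter => f i) E0.
  (* These are the places that the two shifts move to 0, the first place without a letter. Comparing
     there gives both inequalities between [j'] and [-m]. *)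
  have := E (Posz m); have := E (- j')%R.
  move=> E1 E2.
  have /none h1 : y (- j' - m%:Z)%R = None.
    by rewrite E1; apply/none; lia.
  have /none h2 : y (m%:Z + j')%R = None.
    by rewrite -E2; apply/none; lia.
  lia.
- by rewrite /=; lia.
apply/funext => p; rewrite /proj_right /shiftz scatE -/m.
case: (ltnP p m) => pm.
  have -> : (p%:Z - m%:Z)%R = Negz (m - p.+1) by lia.
  by rewrite /biseq_of /strip [pjoin _ _ _]lE.
by have -> : (p%:Z - m%:Z)%R = Posz (p - m) by lia.
Qed.

Lemma W_finite_left K : (forall i, K <= i -> G i = gamma_alpha n i) ->
  let m := size (left_word n G K) in W n G = shiftz m%:Z (pjoin eps (oalpha n)).
Proof.
move=> GK m.
have lk k : K <= k -> left_word n G k = left_word n G K.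
  move=> /subnKC <-; elim: (k - K) => [|d IH]; first by rewrite addn0.
  rewrite addnS left_wordS IH GK ?leq_addr //= /eu /=.
  suff -> : Lam n (K + d) [::] = [::] by [].
  by elim: (K + d).
have w k : K <= k -> Lam n k [:: L3] = left_word n G K ++ right_word n G k.
  by move=> Kk; rewrite -(lk _ Kk) left_right_word // GK.
apply/funext => -[p|q]; rewrite /shiftz /W.
  have -> : (p%:Z + m%:Z)%R = Posz (p + m) by lia.
  pose k := K + (p + m); have Kk : K <= k by exact: leq_addr.
  have kk : p + m < size (Lam n k [:: L3]).
    by apply: leq_ltn_trans (size_Lam3 n0 k); rewrite leq_addl.
  rewrite /= (oalpha_nth kk); move: kk; rewrite w // size_cat -/m addnC ltn_add2l => pk.
  rewrite nth_cat -/m ltnNge leq_addr /= addKn.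
  by have [r1 _] := rlim_right n G p; exact: r1.
have [l1 l2] := llim_left n G q; case: (ltnP q m) => qm.
  have -> : (Negz q + m%:Z)%R = Posz (m - q.+1) by lia.
  have kk : m - q.+1 < size (Lam n K [:: L3]) by rewrite w // size_cat -/m; lia.
  rewrite /= (oalpha_nth kk) w // nth_cat -/m ifT; last by lia.
  rewrite [LHS](l1 K) // nth_rev //.
have -> : (Negz q + m%:Z)%R = Negz (q - m) by lia.
rewrite [RHS]/(eps _); apply: l2 => k; apply: leq_trans qm.
case: (leqP K k) => Kk; first by rewrite lk.
rewrite /m -(subnKC (ltnW Kk)); elim: (K - k) => [|d IH]; first by rewrite addn0.
by rewrite addnS left_wordS size_cat (leq_trans IH) ?leq_addl.
Qed.

(** The completion by beta stays to the left of the place where alpha begins, and the point is [m]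
    places further right. What is seen is alpha without its first [m] letters. *)
Lemma Hmap_finite_left K k : (forall i, K <= i -> G i = gamma_alpha n i) ->
  starts (proj_right (shiftz (exponent [set j | (0 <= j)%R] (W n G) (pjoin eps (oalpha n)))
    (t_seq n))) (right_word n G k).
Proof.
move=> GK; have WE := W_finite_left GK; set m := size _ in WE.
have none i : (pjoin eps (oalpha n) i = None) <-> (i < 0)%R.
  by case: i => i; split=> //=; rewrite oalphaE.
rewrite (exponentE _ WE); last first.
- move=> j' j'0 E0; set y := pjoin _ _ in E0 none.
  have E i : y (i + m%:Z)%R = y (i + j')%R by have := congr1 (fun f : int -> option letter => f i) E0.
  have := E (- j')%R; have := E (- m%:Z)%R.
  move=> E1 E2.
  have h1 : ~ (- m%:Z + j' < 0)%R.
    by move/none; rewrite -E1 => /none; lia.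
  have h2 : ~ (- j' + m%:Z < 0)%R.
    by move/none; rewrite E2 => /none; lia.
  lia.
- by rewrite /=; lia.
have -> : proj_right (shiftz m%:Z (t_seq n)) = iter m shift (alpha n).
  apply/funext => p; rewrite iter_shiftE /proj_right /shiftz.
  by have -> : (p%:Z + m%:Z)%R = Posz (p + m) by lia.
have st k' : K <= k' -> starts (iter m shift (alpha n)) (right_word n G k').
  move=> Kk'; have [z] := alpha_starts n k'.
  have -> : [:: L3] = [:: ea (G k')] by rewrite GK.
  rewrite -left_right_word // scat_cat => ->; exists z.
  have -> : m = size (left_word n G k'); last exact: iter_shift_scat.
  rewrite /m -(subnKC Kk'); elim: (k' - K) => [|d IH]; first by rewrite addn0.
  rewrite addnS left_wordS IH GK ?leq_addr //= /eu /=.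
  suff -> : Lam n (K + d) [::] = [::] by [].
  by elim: (K + d).
case: (leqP K k) => Kk; first exact: st.
have := st _ (leqnn K); rewrite -(subnKC (ltnW Kk)).
elim: (K - k) => [|d IH]; first by rewrite addn0.
by rewrite addnS right_wordS => /starts_catl.
Qed.

Definition right_end_edge i (b : letter) : edge :=
  if b is L2 then ([::], L2, [::]) else (L3 :: nseq (n i) L1, L1, [::]).

(** An empty [v] at the next level rules out the block of 3. The blocks of 1 and 2 end in 2 and 1,
    so the letters alternate; [c] records the parity and thereby the tail class. *)
Lemma right_finite_edges K : (forall i, K <= i -> ev (G i) = [::]) ->
  exists c : bool, forall i, K <= i -> G i = right_end_edge i (if odd i (+) c then L2 else L1).
Proof.
move=> GK; have step i : K <= i ->
    G i = right_end_edge i (ea (G i)) /\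
    (ea (G i), ea (G i.+1)) \in [:: (L1, L2); (L2, L1)].
  move=> Ki; have [a3 _] := path_last n0 Gp (GK _ Ki).
  have [b3 _] := path_last n0 Gp (GK _ (leqW Ki)).
  have := GK _ Ki; move: (Gp i) a3 b3; case: (G i) => -[u a] v.
  rewrite /ea /eu /ev /= => + a3 b3 v0; rewrite {}v0 cats1 !inE.
  case: (G i.+1).1.2 b3 => // _; rewrite /Lambda.
    by rewrite -[[:: L2]]/(rcons [::] L2) => /rcons_inj[<- <-]; rewrite eqxx orbT.
  by rewrite nseqSr -cat_cons cats1 => /rcons_inj[<- <-]; rewrite eqxx.
pose c := odd K (+) (if ea (G K) is L2 then true else false).
exists c => i Ki; have [-> _] := step i Ki; congr right_end_edge.
rewrite -(subnKC Ki); elim: (i - K) => [|d IH].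
  rewrite addn0 /c addKb; have [_] := step K (leqnn _).
  by rewrite !inE => /orP[/eqP[->]|/eqP[->]].
have [_] := step _ (leq_addr d K); rewrite IH addnS /= !inE.
by rewrite addNb; case: (odd _ (+) c) => /orP[] /eqP[].
Qed.

(** All later facts about [Hmap] rest on this dichotomy; the exponents do not appear again. *)
Lemma Hmap_cases :
  (exists K, (forall i, K <= i -> ev (G i) = [::]) /\
     Hmap n G = scat (right_word n G K) (alpha n)) \/
  (~ right_finite G /\ forall k, starts (Hmap n G) (right_word n G k)).
Proof.
rewrite /Hmap; case: asboolP => [[K GK]|Gb].
  left; exists K; split=> [i Ki|]; first by rewrite GK // /gamma_beta; case: odd.
  apply: (@Hmap_finite_right K L1) => // i Ki; rewrite GK // /gamma_beta; first by case: odd.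
  by move=> /negPf ->.
case: asboolP => [[K GK]|Ghb].
  left; exists K; split=> [i Ki|]; first by rewrite GK // /gamma_hbeta; case: odd.
  apply: (@Hmap_finite_right K L2) => // i Ki; rewrite GK // /gamma_hbeta; first by case: odd.
  by move=> /negPf ->.
right; have Gf : ~ right_finite G.
  move=> [K /right_finite_edges[[] GK]]; [apply: Ghb | apply: Gb]; exists K => i Ki;
  by rewrite GK // /gamma_hbeta /gamma_beta; case: odd.
split=> // k; case: asboolP => [[K GK]|_]; first exact: Hmap_finite_left GK.
rewrite -(mkseq_nth L1 (right_word n G k)).
suff -> : mkseq (nth L1 (right_word n G k)) (size (right_word n G k)) =
  mkseq (proj_right (strip (W n G))) (size (right_word n G k)) by exact: starts_mkseq.
apply: (@eq_from_nth _ L1); rewrite !size_mkseq // => i ik.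
rewrite !nth_mkseq // /proj_right /strip /W /=.
by have [r1 _] := rlim_right n G i; rewrite [rlim _ i](r1 k).
Qed.

Lemma Hmap_head : Hmap n G 0 = ea (G 0).
Proof. by case: Hmap_cases => [[K [_ ->]]//|[_ h]]; have [z ->] := h 0. Qed.

(** Right words are suffixes of [Lam n k [:: ea (G k)]]. In the completed case the junction with
    alpha lies in the image of 13 or 23, both factors at level [k]. *)
Lemma admissible_Hmap : admissible n (Hmap n G).
Proof.
have nk k i : 0 < iter k (@tail nat) n i by rewrite iter_tailE.
case: Hmap_cases => [[K [GK ->]]|[Gf h]]; apply: admissible_starts => L; last first.
  have [k Lk] := right_word_unbounded n L Gf; exists (right_word n G k); split=> //.
  have := @lang_Lam n k _ (lang1 (ea (G k)) (nk k)); apply: lang_infix.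
  by rewrite -left_right_word // suffix_infix.
pose k := maxn K L; have Kk : K <= k by exact: leq_maxl.
exists (right_word n G K ++ Lam n k [:: L3]); split.
- rewrite size_cat; apply: leq_trans (leq_addl _ _).
  by apply: leq_trans (ltnW (size_Lam3 n0 k)); exact: leq_maxr.
- by have [z ->] := alpha_starts n k; exists z; rewrite scat_cat.
- have [a3 _] := path_last n0 Gp (GK _ Kk).
  have : lang (iter k (@tail nat) n) [:: ea (G k); L3].
    by case: (ea (G k)) a3 => // _; [exact: lang13 | exact: lang23].
  move=> /lang_Lam; apply: lang_infix.
  rewrite -[[:: ea (G k); L3]]/([:: ea (G k)] ++ [:: L3]) Lam_cat -left_right_word //.
  by rewrite -catA (right_word_const n GK Kk) suffix_infix.
Qed.

End HmapCases.

(** [behead] drops the letter [ea (G 1)], whose block already supplies [ea (G 0) :: ev (G 0)]. *)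
Lemma right_word_tail n G k : right_word n G k.+1 =
  ea (G 0) :: ev (G 0) ++ Lambda_word (n 0) (behead (right_word (tail n) (tail G) k)).
Proof.
elim: k => [|k IH]; first by rewrite /right_word /= cats0.
rewrite right_wordS IH right_wordS /= Lambda_word_cat -catA.
by rewrite -[Lam n k _]/(Lam n k.+1 _) Lam_tail.
Qed.

Lemma Hmap_desub n G : (forall i, 0 < n i) -> is_path n G ->
  desub (n 0) (Hmap n G) (G 0) (Hmap (tail n) (tail G)).
Proof.
move=> n0 Gp; have tn0 : forall i, 0 < tail n i by move=> i; exact: n0.
have tGp : is_path (tail n) (tail G) by move=> i; exact: Gp.
split; first by rewrite Hmap_head // Gp.
have rE m F k : right_word m F k = ea (F 0) :: behead (right_word m F k) by [].
case: (Hmap_cases n0 Gp) => [[K [GK ->]]|[Gf h]].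
  case: (Hmap_cases tn0 tGp) => [[K' [GK' ->]]|[[]]]; last first.
    by exists K => i Ki; apply: GK; exact: leqW.
  pose k := maxn K K'; have Kk : K <= k.+1 by apply: leqW; exact: leq_maxl.
  have Kk' : K' <= k by exact: leq_maxr.
  rewrite -(right_word_const n GK Kk) -(right_word_const (tail n) GK' Kk').
  rewrite right_word_tail alpha_LambdaS // [in RHS]rE.
  by rewrite shift_scat LambdaS_scat -cat_cons scat_cat.
case: (Hmap_cases tn0 tGp) => [[K [GK _]]|[Gf' h']].
  by case: Gf; exists K.+1 => -[|i] // Ki; exact: GK.
apply: starts_eq => L; have [k Lk] := right_word_unbounded n L Gf.
exists (right_word n G k.+1); split=> //.
  by apply: leq_trans Lk _; rewrite right_wordS size_cat leq_addr.
rewrite right_word_tail; have [z ->] := h' k.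
rewrite {1}rE shift_scat LambdaS_scat -scat_cat -cat_cons.
by eexists.
Qed.

Lemma codes_Hmap n G : (forall i, 0 < n i) -> is_path n G -> codes n G (Hmap n G).
Proof.
move=> n0 Gp; exists (fun i => Hmap (iter i (@tail nat) n) (iter i (@tail edge) G)) => // i.
have nk k : 0 < iter i (@tail nat) n k by rewrite iter_tailE.
have Gk : is_path (iter i (@tail nat) n) (iter i (@tail edge) G).
  by move=> k; rewrite !iter_tailE Gp.
split; first exact: admissible_Hmap.
by have := Hmap_desub nk Gk; rewrite ![iter i _ _ 0]iter_tailE.
Qed.

(** * Product topology and two-sided sequences *)

Import Order.TTheory GRing.Theory Num.Theory.
Local Open Scope classical_set_scope.
Local Open Scope ring_scope.

Lemma ptws_cvg (I : choiceType) (F : set_system {ptws I -> letter}) (x : {ptws I -> letter}) :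
  Filter F -> (forall i, \forall y \near F, y i = x i) -> F --> x.
Proof.
move=> FF h; apply/cvg_sup => i; apply/cvg_image.
  by rewrite eqEsubset; split => // o _; exists (fun=> o).
move=> U /principal_filterP Ux; exists [set y : {ptws I -> letter} | U (y i)].
  by apply: filterS (h i) => y /= ->.
by rewrite eqEsubset; split => [o [y Uy <-]|o Uo] //; exists (fun=> o).
Qed.

Lemma ptws_nbhs (I : choiceType) (x : {ptws I -> letter}) i :
  \forall y \near nbhs x, y i = x i.
Proof.
have /(_ [set x i]) := @proj_continuous I (fun=> letter) i x.
by apply.
Qed.

(** The lists [J k] eventually contain each index: initial segments of the naturals for [DeltaPE],
    symmetric windows of the integers for [DeltaE]. *)
Lemma closure_agree (I : choiceType) (A : set {ptws I -> letter}) (x : {ptws I -> letter})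
    (J : nat -> seq I) : (forall i, exists k, forall k', (k <= k')%N -> i \in J k') ->
  closure A x <-> forall k, exists2 y, A y & {in J k, x =1 y}.
Proof.
move=> hJ; split=> [Ax k|h].
  have /Ax[y [Ay xy]] : nbhs x [set y : {ptws I -> letter} | {in J k, x =1 y}].
    elim: (J k) => [|i r IH]; first by apply: filterE.
    apply: filterS2 (ptws_nbhs x i) IH => y yi yr j; rewrite inE => /predU1P[->//|]; exact: yr.
  by exists y.
have /choice[y hy] : forall k, exists y, A y /\ {in J k, x =1 y}.
  by move=> k; have [y] := h k; exists y.
have cy : y @ \oo --> (x : {ptws I -> letter}).
  apply: ptws_cvg => i; have [k hk] := hJ i.
  by exists k => // k' /= kk'; symmetry; apply: (hy k').2; exact: hk.
move=> B /cy [k _ /(_ k (leqnn k)) Bk].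
by exists (y k); split=> //; exact: (hy k).1.
Qed.

Lemma DeltaPE n : (forall i, (0 < n i)%N) -> DeltaP n = admissible n.
Proof.
move=> n0; apply/funext => s; apply/propext; rewrite (admissibleP n0).
rewrite [DeltaP n s](@closure_agree nat _ _ (iota 0)); last first.
  by move=> i; exists i.+1 => k; rewrite mem_iota.
split=> h K.
  by have [y [p _ <-] hy] := h K; exists p => i iK; apply: hy; rewrite mem_iota.
have [p hp] := h K; exists (iter p shift (alpha n)); first by exists p.
by move=> i; rewrite mem_iota => iK; exact: hp.
Qed.

(** Two-sided sequences are studied through these right halves, to which the one-sided results
    apply. *)
Definition rhalf (s : biseq) (i : nat) : oneseq := fun k => s (k%:Z - i%:Z).

Lemma rhalf0 s : rhalf s 0 = proj_right s.
Proof. by apply/funext => k; rewrite /rhalf subr0. Qed.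

Lemma rhalfS s i : rhalf s i.+1 = scons (s (Negz i)) (rhalf s i).
Proof. by apply/funext => -[|k]; rewrite /rhalf /=; congr s; lia. Qed.

Lemma rhalf_shift s i d : iter d shift (rhalf s (i + d)) = rhalf s i.
Proof. by apply/funext => k; rewrite iter_shiftE /rhalf; congr s; lia. Qed.

(** As [j] may be negative, one starts [absz j] places further left and drops a nonnegative number
    of letters. *)
Lemma rhalf_shiftz s (j : int) i :
  rhalf (shiftz j s) i = iter (absz (j + (absz j)%:Z)) shift (rhalf s (i + absz j)%N).
Proof. by apply/funext => k; rewrite iter_shiftE /rhalf /shiftz; congr s; lia. Qed.

Lemma rhalf_ext s s' : (forall i, rhalf s i = rhalf s' i) -> s = s'.
Proof.
move=> h; apply/funext => i.
have := congr1 (fun x : oneseq => x (absz (i + (absz i)%:Z))) (h (absz i)).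
rewrite /rhalf; have -> // : (absz (i + (absz i)%:Z))%:Z - (absz i)%:Z = i by lia.
Qed.

Section Shifts.
Variable n : nat -> nat.
Hypothesis n0 : forall i, (0 < n i)%N.

Lemma rhalf_biseq_of b k : b <> L3 ->
  let w := Lam n k.*2 [:: b] in rhalf (biseq_of n b) (size w) = scat w (alpha n).
Proof.
move=> b3 w; apply/funext => p; rewrite scatE /rhalf; case: ltnP => pw.
  have -> : p%:Z - (size w)%:Z = Negz (size w - p.+1) by lia.
  rewrite (@biseq_of_nth _ _ b3 k) -/w ?nth_rev; try lia.
  by congr nth; lia.
by have -> : p%:Z - (size w)%:Z = Posz (p - size w) by lia.
Qed.

Lemma rhalf_biseq_of1 b : b <> L3 -> rhalf (biseq_of n b) 1 = scons b (alpha n).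
Proof. by move=> b3; rewrite -[1%N]/(size (Lam n 0.*2 [:: b])) rhalf_biseq_of. Qed.

Lemma admissible_biseq_of b i : b <> L3 -> admissible n (rhalf (biseq_of n b) i).
Proof.
move=> b3 L; pose k := (i + L)%N; set w := Lam n k.*2 [:: b].
have kw : (i + L < size w)%N by exact: size_Lam_double.
have k3 : (L < size (Lam n k.*2 [:: L3]))%N.
  by apply: leq_ltn_trans (size_Lam3 n0 _); rewrite -addnn /k; lia.
have iw : (i <= size w)%N by lia.
rewrite -(rhalf_shift (biseq_of n b) i (size w - i)) subnKC //.
apply: lang_infix (infix_mkseq _ _ _) _; rewrite rhalf_biseq_of //.
have st : starts (scat w (alpha n)) (w ++ Lam n k.*2 [:: L3]).
  by have [z ->] := alpha_starts n k.*2; exists z; rewrite scat_cat.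
have : lang n (w ++ Lam n k.*2 [:: L3]).
  have kn j : (0 < iter k.*2 (@tail nat) n j)%N by rewrite iter_tailE.
  rewrite /w -Lam_cat; apply: lang_Lam.
  by case: b b3 {w kw iw st} => // _; [exact: lang13 | exact: lang23].
apply: lang_infix; rewrite -(starts_mkseqE st) size_cat.
set l := (X in mkseq _ X); set l' := (X in infix _ (mkseq _ X)).
have ll : (l <= l')%N by rewrite /l /l'; lia.
by rewrite -(subnKC ll) mkseqD prefix_infix.
Qed.

(** A finite window of [s] is a prefix of some right half, hence a factor of alpha, and so it
    appears in [t_seq] to the right of the point. *)
Lemma DeltaE s : Delta n s <-> forall i, admissible n (rhalf s i).
Proof.
pose J k := [seq Posz i | i <- iota 0 k] ++ [seq Negz i | i <- iota 0 k].
have JP i k : Posz i \in J k = (i < k)%N.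
  rewrite mem_cat [X in _ || X](_ : _ = false) ?orbF; last by apply/mapP => -[].
  by rewrite mem_map ?mem_iota // => ? ? [].
have JN i k : Negz i \in J k = (i < k)%N.
  rewrite mem_cat [X in X || _](_ : _ = false) /=; last by apply/mapP => -[].
  by rewrite mem_map ?mem_iota // => ? ? [].
rewrite [Delta n s](@closure_agree int _ _ J); last first.
  by move=> [] i; exists i.+1 => k; rewrite ?JP ?JN.
split=> [h i|h K].
  apply: admissible_agree => K; have [y [j _ <-] hy] := h (i + K)%N.
  exists (rhalf (shiftz j (t_seq n)) i); split.
    by rewrite rhalf_shiftz; apply/admissible_shift/(@admissible_biseq_of L1).
  move=> p pK; apply: hy; case: (leqP i p) => ip.
    by rewrite (_ : p%:Z - i%:Z = Posz (p - i)) ?JP; lia.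
  by rewrite (_ : p%:Z - i%:Z = Negz (i - p.+1)) ?JN; lia.
have [p hp] := (admissibleP n0 _).1 (h K) (K + K)%N.
(* The window begins at place [-K] of [s] and at place [p] of alpha. *)
exists (shiftz (K + p)%N%:Z (t_seq n)); first by exists (K + p)%N%:Z.
have hp' q : (q < K + K)%N -> s (q%:Z - K%:Z) = t_seq n (Posz (q + p)).
  by move=> qK; rewrite -[LHS]/(rhalf s K q) hp // iter_shiftE.
move=> [] q; rewrite ?JP ?JN => qK; rewrite /shiftz.
  have -> : Posz q = (q + K)%N%:Z - K%:Z by lia.
  by rewrite hp'; [congr t_seq; lia | lia].
have -> : Negz q = (K - q.+1)%N%:Z - K%:Z by lia.
by rewrite hp'; [congr t_seq; lia | lia].
Qed.

Lemma Delta_biseq_of b (j : int) : b <> L3 -> Delta n (shiftz j (biseq_of n b)).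
Proof.
by move=> b3; apply/DeltaE => i; rewrite rhalf_shiftz; apply/admissible_shift/admissible_biseq_of.
Qed.

Lemma admissible_pred s : admissible n s -> s <> alpha n ->
  exists a, admissible n (scons a s).
Proof.
move=> sn sa; apply: contrapT => h.
have [i0 si] : exists i, s i <> alpha n i.
  by apply: contrapT => sE; apply: sa; apply/funext => i; apply: contrapT => si; apply: sE; exists i.
have /choice[K HK] : forall a, exists K, ~ lang n (mkseq (scons a s) K).
  by move=> a; apply: contrapT => aK; apply: h; exists a => k; apply: contrapT => ?; apply: aK; exists k.
(* [M] exceeds [i0], so the occurrence in alpha is not at its beginning, and it covers the failure
   lengths of all three letters. *)
pose M := (i0 + K L1 + K L2 + K L3).+1.
have [[|p] hp] := (admissibleP n0 s).1 sn M.
  by apply: si; apply: hp; rewrite /M; lia.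
apply: (HK (alpha n p)).
have aE : agree (K (alpha n p)) (scons (alpha n p) s) (iter p shift (alpha n)).
  move=> [|i] iK; rewrite iter_shiftE //= hp ?iter_shiftE ?addSnnS // /M.
  by case: (alpha n p) iK => /=; lia.
by rewrite (agree_mkseq aE); apply: admissible_shift; exact: admissible_alpha.
Qed.

Lemma admissible_alpha_pred a : admissible n (scons a (alpha n)) -> a <> L3.
Proof. by move=> /(admissible_ok n0) /=; rewrite alpha0; case: a. Qed.

(** Once the letter before alpha is chosen, all letters further left are forced: a second choice
    would give a longer right half two predecessors. That half would again be alpha, against
    aperiodicity. *)
Lemma biseq_of_uniq s i : (forall k, admissible n (rhalf s k)) ->
  rhalf s i = alpha n -> s = shiftz i%:Z (biseq_of n (s (Negz i))).
Proof.
move=> sn si; set b := s (Negz i).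
have b3 : b <> L3 by apply: admissible_alpha_pred; rewrite /b -si -rhalfS.
pose z : biseq := shiftz (- i%:Z) s.
have zE k : rhalf z k = rhalf s (k + i).
  by apply/funext => p; rewrite /rhalf /z /shiftz; congr s; lia.
have zb0 : rhalf (biseq_of n b) 0 = alpha n by rewrite rhalf0.
suff zb : z = biseq_of n b.
  by rewrite -zb; apply/funext => k; rewrite /shiftz /z /shiftz; congr s; lia.
apply: rhalf_ext; elim=> [|[|k] IH]; first by rewrite zE zb0 si.
  by rewrite zE add1n rhalfS si rhalf_biseq_of1.
rewrite !(rhalfS _ k.+1) IH; congr scons; apply: contrapT => zb.
have /(two_preds_alpha n0) E : two_preds n (rhalf (biseq_of n b) k.+1).
  exists (z (Negz k.+1)), (biseq_of n b (Negz k.+1)); split=> //.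
    by rewrite -IH -rhalfS zE; exact: sn.
  by rewrite -rhalfS; exact: admissible_biseq_of.
apply: (@alpha_aperiodic n k.+1 n0) => //.
by rewrite -{1}E -[k.+1]add0n rhalf_shift.
Qed.

Lemma proj_right_inj s s' : Delta n s -> Delta n s' -> proj_right s = proj_right s' ->
  s = s' \/ exists j : nat,
    (s = shiftz j%:Z (t_seq n) /\ s' = shiftz j%:Z (t_hat n)) \/
    (s = shiftz j%:Z (t_hat n) /\ s' = shiftz j%:Z (t_seq n)).
Proof.
move=> /DeltaE sn /DeltaE sn'; rewrite -!rhalf0 => ss'.
case: (pselect (forall i, rhalf s i = rhalf s' i)) => [/rhalf_ext|h]; first by left.
(* The first place to the left of the point where the sequences differ; the common right half from
   there on has two predecessors. *)
right; have [j sj sj'] : exists2 j, rhalf s j = rhalf s' j & s (Negz j) <> s' (Negz j).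
  apply: contrapT => H; apply: h; elim=> // i IH; rewrite !rhalfS IH; congr scons.
  by apply: contrapT => ?; apply: H; exists i.
have sa : rhalf s j = alpha n.
  apply: two_preds_alpha => //; exists (s (Negz j)), (s' (Negz j)).
  by split=> //; [rewrite -rhalfS | rewrite sj -rhalfS].
have sE := biseq_of_uniq sn sa; have sE' := biseq_of_uniq sn' (etrans (esym sj) sa).
have b3 : s (Negz j) <> L3 by apply: admissible_alpha_pred; rewrite -sa -rhalfS.
have b3' : s' (Negz j) <> L3 by apply: admissible_alpha_pred; rewrite -sa sj -rhalfS.
exists j; move: sj' b3 b3' sE sE'.
by case: (s (Negz j)) (s' (Negz j)) => [] [] // _ _ _ sE sE'; [left | right].
Qed.

End Shifts.

(** * Continuity of H and of its inverse *)

Section Homeomorphism.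
Variables (R : realType) (n : nat -> nat).
Hypothesis n0 : forall i, (0 < n i)%N.
Implicit Types G : path_space R n.

Lemma path_spaceP G : is_path n G.
Proof. exact: set_valP G. Qed.

Lemma path_dist_lt G G' N : path_dist G G' < N.+1%:R^-1 ->
  forall i, (i <= N)%N -> G' i = G i.
Proof.
move=> GG i iN; apply/eqP; rewrite eq_sym; apply/negPn/negP => /path_dist_ge h.
have := le_lt_trans h GG; rewrite ltf_pV2 ?posrE ?ltr0n // ltr_nat; lia.
Qed.

Lemma path_dist_le G G' N : (forall i, (i <= N)%N -> G i = G' i) ->
  path_dist G G' < N.+1%:R^-1.
Proof.
move=> GG; rewrite /path_dist; case: pselect => [h|_]; last by rewrite invr_gt0 ltr0n.
case: ex_minnP => m Gm _; rewrite ltf_pV2 ?posrE ?ltr0n // ltr_nat ltnS ltnNge.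
by apply: contra Gm => mN; rewrite GG.
Qed.

Lemma Hmap_continuous : continuous (fun G : path_space R n => Hmap n G : oneseq).
Proof.
move=> G; apply: (@ptws_cvg nat _ _ (fmap_filter _ (nbhs_filter G))) => i.
have [N [q [iq hq]]] := codes_prefix i.+1 n0 (path_spaceP G).
have : \forall G' \near G, ball G (N.+1%:R^-1 : R) G'.
  by apply: nbhsx_ballx; rewrite invr_gt0 ltr0n.
apply: filterS => G'; rewrite ballEmdist /= => /path_dist_lt GG.
have qG := hq _ _ (codes_Hmap n0 (path_spaceP G)) (fun _ _ => erefl).
by have := hq _ _ (codes_Hmap n0 (path_spaceP G')) GG; move=> /starts_agree /(_ qG); apply.
Qed.

Lemma Hmap_bij : set_bij [set: path_space R n] (DeltaP n) (fun G => Hmap n G).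
Proof.
split=> [G _|G G' _ _ GG|s].
- by rewrite DeltaPE //; apply: admissible_Hmap => //; exact: path_spaceP.
- apply: path_ext => i; have [M HM] := codes_agree i n0.
  apply: HM (codes_Hmap n0 (path_spaceP G)) (codes_Hmap n0 (path_spaceP G')) _ _ (leqnn i).
  by rewrite GG.
- rewrite DeltaPE // => sn; have [G Gp sG] := codes_exists n0 sn.
  exists (exist _ G (mem_set Gp) : path_space R n) => //.
  exact: codes_inj n0 Gp (codes_Hmap n0 Gp) sG.
Qed.

Lemma Hmap_homeomorphism :
  homeomorphism_onto (DeltaP n) (fun G : path_space R n => Hmap n G).
Proof.
split; [exact: Hmap_continuous | exact: Hmap_bij |].
have [_ Hinj Hsurj] := Hmap_bij.
pose G0 : path_space R n := exist _ (gamma_alpha n) (mem_set (gamma_alpha_path n)).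
(* Outside the image of [Hmap] the inverse takes the default value [G0]. *)
pose g s : path_space R n := if pselect (exists G : path_space R n, Hmap n G = s) is left h
  then projT1 (cid h) else G0.
have gH G : Hmap n (g (Hmap n G)) = Hmap n G.
  by rewrite /g; case: pselect => [h|[]]; [case: cid | exists G].
exists g; first by move=> G; apply: Hinj (gH G); rewrite inE.
apply/subspace_continuousP => s sD; apply/cvg_ballP => eps eps0.
have [N Neps] : exists N, (N.+1%:R^-1 : R) < eps by have [N] := ltr_add_invr eps0; rewrite add0r; exists N.
have [M HM] := codes_agree N n0.
have : \forall s' \near within (DeltaP n) (nbhs s), DeltaP n s' /\ agree M s s'.
  rewrite near_withinE.
  have : \forall s' \near nbhs s, agree M s s'.
    elim: (M) => [|k IH]; first by apply: filterE.
    apply: filterS2 (ptws_nbhs s k) IH => s' sk h i.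
    by rewrite ltnS leq_eqVlt => /predU1P[->|/h].
  by apply: filterS => s' ? ?; split.
apply: filterS => s' [s'D ss']; rewrite ballEmdist /=; apply: lt_trans Neps.
apply: path_dist_le; have [G _ Gs] := Hsurj _ sD; have [G' _ Gs'] := Hsurj _ s'D.
apply: HM (codes_Hmap n0 (path_spaceP _)) (codes_Hmap n0 (path_spaceP _)) _.
by rewrite -Gs -Gs' !gH Gs Gs'.
Qed.

End Homeomorphism.

Theorem theorem6p1 (R : realType) (n : nat -> nat) (hn : forall i, (0 < n i)%N) :
  [/\ homeomorphism_onto (DeltaP n) (fun G : path_space R n => Hmap n G),
      [/\ set_fun (Delta n) (DeltaP n) proj_right,
          (forall j : nat,
             [/\ Delta n (shiftz j%:Z (t_seq n)), Delta n (shiftz j%:Z (t_hat n)),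
                 shiftz j%:Z (t_seq n) <> shiftz j%:Z (t_hat n) &
                 proj_right (shiftz j%:Z (t_seq n)) =
                 proj_right (shiftz j%:Z (t_hat n))]) &
          (forall s s' : biseq, Delta n s -> Delta n s' ->
             proj_right s = proj_right s' ->
             s = s' \/
             exists j : nat,
               (s = shiftz j%:Z (t_seq n) /\ s' = shiftz j%:Z (t_hat n)) \/
               (s = shiftz j%:Z (t_hat n) /\ s' = shiftz j%:Z (t_seq n)))] &
      [/\ set_fun (DeltaP n) (DeltaP n) shift,
          (forall s : oneseq, DeltaP n s -> s <> alpha n ->
             exists! s' : oneseq, DeltaP n s' /\ shift s' = s) &
          DeltaP n `&` shift @^-1` [set alpha n] =
          [set scons L1 (alpha n); scons L2 (alpha n)]]].
Proof.
have b1 : L1 <> L3 by []. have b2 : L2 <> L3 by [].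
split; first exact: Hmap_homeomorphism.
  split.
  - by move=> s /(DeltaE hn)/(_ 0%N); rewrite rhalf0 DeltaPE.
  - move=> j; split; [exact: (@Delta_biseq_of n hn L1) | exact: (@Delta_biseq_of n hn L2) | | by []].
    (* The two sequences differ just left of the point of [t_seq], which the shift moves to
       [Negz j]. *)
    move=> /(congr1 (fun s : biseq => s (Negz j))); rewrite /shiftz.
    have -> : Negz j + j%:Z = Negz 0 by lia.
    by rewrite -[t_seq n]/(biseq_of n L1) -[t_hat n]/(biseq_of n L2) !(@biseq_of_nth _ _ _ 0).
  - exact: proj_right_inj.
rewrite DeltaPE //; split.
- by move=> s /(@admissible_shift n s 1).
- move=> s sn sa; have [a asn] := admissible_pred hn sn sa.
  exists (scons a s); split=> [|s' [sn' s's]]; first by split.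
  (* A second preimage with another first letter would make [s] equal to alpha. *)
  rewrite -(scons_shift s') s's; congr scons; apply: contrapT => aa; apply: sa.
  apply: (two_preds_alpha hn); exists a, (s' 0%N); split=> //.
  by rewrite -s's scons_shift.
- have sb b : b <> L3 -> admissible n (scons b (alpha n)).
    by move=> b3; rewrite -rhalf_biseq_of1 //; exact: admissible_biseq_of.
  apply/seteqP; split=> [s [sn /= sa]|s [] ->]; last 2 first.
  - by split; [exact: sb |].
  - by split; [exact: sb |].
  move: sn; rewrite -(scons_shift s) sa => /(admissible_alpha_pred hn).
  by case: (s 0%N) => // _; [left | right].
Qed.
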